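(* Let $T$ be a complete NIP $L$-theory, $G$ a group type-definable over $M_0 \models T$, and $M \succ M_0$ an $|M_0|^{+}$-saturated model. Assume that $G$ is fsg in $T$ as a type-definable group, and that $G(M)$ is definable in $M^{\mathrm{Sh}}$. Then $G$ is already a definable group in $M$ (hence $G$ is fsg as a definable group in $T' := \mathrm{Th}(M^{\mathrm{Sh}})$).
   Context: $M^{\mathrm{Sh}}$ is the Shelah expansion of $M$: fix an $|M|^+$-saturated $N\succeq M$; $M^{\mathrm{Sh}}$ is $M$ expanded by a relation symbol for every externally definable set, i.e. every set $\varphi(M,d)=\{a\in M^n: N\models\varphi(a,d)\}$ with $\varphi(x,y)\in L$ and $d$ in $N$. A type-definable group over $M_0$ is a group whose underlying set (in a finite tuple of variables) is the set of realizations in the monster model of a partial type over $M_0$ and whose multiplication is given by an $M_0$-definable (partial) function. In a theory with monster model $\mathbb{M}$, a type-definable (in particular, definable) group $G$ is fsg if there are a global type $p\in S_G(\mathbb{M})$ (i.e. concentrating on $G$) and a small model $M_1\prec\mathbb{M}$ such that $G$ is type-definable over $M_1$ and for every $g\in G(\mathbb{M})$ the translate $g\cdot p$ is finitely satisfiable in $G(M_1)$. *)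

(* Defs.v *)
Set Warnings "-notation-overridden,-notation-incompatible-prefix".
From mathcomp Require Import all_boot.
From mathcomp Require Import boolp classical_sets functions cardinality.
Set Implicit Arguments.
Unset Strict Implicit.
Unset Printing Implicit Defensive.

Local Open Scope classical_set_scope.
Local Open Scope card_scope.

(* One-sorted first-order logic.  The free variables of a formula are indexed
   by an arbitrary type [V], so that
     - [formula L void]            is the type of sentences,
     - [formula L ('I_m + 'I_k)]   is the type of partitioned formulas
                                   phi(x_0..x_{m-1}; y_0..y_{k-1}),
     - [formula L ('I_n + A)]      is the type of L(A)-formulas in n variables.
   A parameter set in a structure [S] is presented as a family [c : A -> S]. *)

Record language := Language {
  fun_sym : Type;
  rel_sym : Type;
  fun_arity : fun_sym -> nat;
  rel_arity : rel_sym -> nat }.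

Inductive term (L : language) (V : Type) : Type :=
| Var of V
| App (f : fun_sym L) of ('I_(fun_arity f) -> term L V).

(* In [All phi] the bound variable is [None]. *)
Inductive formula (L : language) (V : Type) : Type :=
| Bot
| Eq of term L V & term L V
| Atom (r : rel_sym L) of ('I_(rel_arity r) -> term L V)
| Imp of formula L V & formula L V
| All of formula L (option V).

Arguments Bot {L V}.

Definition Neg (L : language) (V : Type) (phi : formula L V) : formula L V :=
  Imp phi Bot.

Fixpoint term_rename (L : language) (V W : Type) (f : V -> W) (t : term L V)
    : term L W :=
  match t with
  | Var v => Var L (f v)
  | App s args => App (fun i => term_rename f (args i))
  end.

Fixpoint rename (L : language) (V W : Type) (f : V -> W) (phi : formula L V)
    : formula L W :=
  match phi with
  | Bot => Bot
  | Eq t u => Eq (term_rename f t) (term_rename f u)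
  | Atom r args => Atom (fun i => term_rename f (args i))
  | Imp p q => Imp (rename f p) (rename f q)
  | All p => All (rename (omap f) p)
  end.

Record structure (L : language) := Structure {
  carrier :> Type;
  carrier_inhabited : inhabited carrier;
  fun_int : forall f : fun_sym L, ('I_(fun_arity f) -> carrier) -> carrier;
  rel_int : forall r : rel_sym L, ('I_(rel_arity r) -> carrier) -> Prop }.

Fixpoint eval (L : language) (S : structure L) (V : Type) (rho : V -> S)
    (t : term L V) : S :=
  match t with
  | Var v => rho v
  | App f args => fun_int (fun i => eval rho (args i))
  end.

Fixpoint sat (L : language) (S : structure L) (V : Type) (rho : V -> S)
    (phi : formula L V) : Prop :=
  match phi with
  | Bot => False
  | Eq t u => eval rho t = eval rho u
  | Atom r args => rel_int (fun i => eval rho (args i))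
  | Imp p q => sat rho p -> sat rho q
  | All p => forall a : S, sat (oapp rho a) p
  end.

Definition env (X Y M : Type) (f : X -> M) (g : Y -> M) (z : X + Y) : M :=
  match z with inl x => f x | inr y => g y end.

Definition models (L : language) (T : set (formula L void)) (S : structure L)
    : Prop :=
  forall sigma, T sigma -> sat (of_void S) sigma.

Definition entails (L : language) (T : set (formula L void))
    (sigma : formula L void) : Prop :=
  forall S : structure L, models T S -> sat (of_void S) sigma.

Definition complete_theory (L : language) (T : set (formula L void)) : Prop :=
  (exists S : structure L, models T S) /\
  (forall sigma, entails T sigma \/ entails T (Neg sigma)).

Definition NIP_theory (L : language) (T : set (formula L void)) : Prop :=
  forall (S : structure L), models T S ->
  forall (m k : nat) (phi : formula L ('I_m + 'I_k)),
  ~ exists (a : nat -> 'I_m -> S) (b : set nat -> 'I_k -> S),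
      forall (i : nat) (s : set nat), sat (env (a i) (b s)) phi <-> s i.

(* [M] being an elementary substructure of [N] is rendered by an embedding [e : M -> N]. *)
Definition elementary (L : language) (M N : structure L) (e : M -> N) : Prop :=
  forall (n : nat) (phi : formula L 'I_n) (a : 'I_n -> M),
    sat a phi <-> sat (e \o a) phi.

Definition automorphism (L : language) (S : structure L) (s : S -> S) : Prop :=
  [/\ bijective s,
      forall (f : fun_sym L) (a : 'I_(fun_arity f) -> S),
        s (fun_int a) = fun_int (s \o a) &
      forall (r : rel_sym L) (a : 'I_(rel_arity r) -> S),
        rel_int a <-> rel_int (s \o a)].

Definition defset (L : language) (S : structure L) (A X : Type) (c : A -> S)
    (phi : formula L (X + A)) : set (X -> S) :=
  [set a | sat (env a c) phi].

Definition typeset (L : language) (S : structure L) (A X : Type) (c : A -> S)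
    (pi : set (formula L (X + A))) : set (X -> S) :=
  [set a | forall phi, pi phi -> defset c phi a].

Definition finitely_satisfiable_in (L : language) (S : structure L)
    (A X : Type) (c : A -> S) (Y : set (X -> S)) (Phi : set (formula L (X + A)))
    : Prop :=
  forall F : set (formula L (X + A)), finite_set F -> F `<=` Phi ->
    exists2 a, Y a & typeset c F a.

Definition realizes_types_over (L : language) (S : structure L) (A : Type)
    (c : A -> S) : Prop :=
  forall (n : nat) (Phi : set (formula L ('I_n + A))),
    finitely_satisfiable_in c setT Phi -> exists a, typeset c Phi a.

(* Cardinals are given by types: [card_lt A K] is |A| < |K|. *)
Definition card_lt (A K : Type) : Prop := ~~ ([set: K] #<= [set: A]).

(* |K|-saturation *)
Definition saturated (K : Type) (L : language) (S : structure L) : Prop :=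
  forall (A : Type) (c : A -> S), card_lt A K -> realizes_types_over c.

(* |K|^+-saturation *)
Definition succ_saturated (K : Type) (L : language) (S : structure L) : Prop :=
  forall (A : Type) (c : A -> S), [set: A] #<= [set: K] ->
    realizes_types_over c.

Definition strongly_homogeneous (K : Type) (L : language) (S : structure L)
    : Prop :=
  forall (A : Type) (c d : A -> S), card_lt A K ->
    (forall phi : formula L A, sat c phi <-> sat d phi) ->
    exists2 s : S -> S, automorphism s & forall x, s (c x) = d x.

(* A monster model, with "small" meaning of cardinality < |K|; the second
   condition says |L| + aleph_0 < |K|. *)
Definition monster (K : Type) (L : language) (U : structure L) : Prop :=
  [/\ saturated K U, card_lt (formula L nat) K & strongly_homogeneous K U].

(* A group in a structure [S] is a set [G] of n-tuples together with the graph
   [R] of its multiplication; only the restriction of [R] to [G] matters. *)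
Definition group_on (X : Type) (G : set X) (R : X -> X -> X -> Prop) : Prop :=
  [/\ forall a b, G a -> G b ->
        exists2 d, G d & forall d', R a b d' <-> d' = d,
      forall a b c u v w, G a -> G b -> G c ->
        R a b u -> R b c v -> R u c w -> R a v w &
      exists2 e, G e &
        forall a, G a -> [/\ R e a a, R a e a &
                             exists2 b, G b & R a b e /\ R b a e]].

(* The ternary relation defined by mu(x, y, z). *)
Definition graph (L : language) (S : structure L) (A : Type) (n : nat)
    (c : A -> S) (mu : formula L ('I_n + 'I_n + 'I_n + A))
    (a b d : 'I_n -> S) : Prop :=
  sat (env (env (env a b) d) c) mu.

(* [R] is, on [G], the partial function defined by [mu] over [c]. *)
Definition multiplication_by (L : language) (S : structure L) (A : Type)
    (n : nat) (c : A -> S) (mu : formula L ('I_n + 'I_n + 'I_n + A))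
    (G : set ('I_n -> S)) (R : ('I_n -> S) -> ('I_n -> S) -> ('I_n -> S) -> Prop)
    : Prop :=
  (forall a b d d', graph c mu a b d -> graph c mu a b d' -> d = d') /\
  (forall a b d, G a -> G b -> (R a b d <-> graph c mu a b d)).

Definition type_definable_group (L : language) (S : structure L) (A : Type)
    (n : nat) (c : A -> S) (pi : set (formula L ('I_n + A)))
    (mu : formula L ('I_n + 'I_n + 'I_n + A))
    (G : set ('I_n -> S)) (R : ('I_n -> S) -> ('I_n -> S) -> ('I_n -> S) -> Prop)
    : Prop :=
  [/\ G = typeset c pi, multiplication_by c mu G R & group_on G R].

Definition definable_group (L : language) (S : structure L) (A : Type)
    (n : nat) (c : A -> S) (psi : formula L ('I_n + A))
    (mu : formula L ('I_n + 'I_n + 'I_n + A))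
    (G : set ('I_n -> S)) (R : ('I_n -> S) -> ('I_n -> S) -> ('I_n -> S) -> Prop)
    : Prop :=
  [/\ G = defset c psi, multiplication_by c mu G R & group_on G R].

Definition complete_type (L : language) (U : structure L) (n : nat)
    (p : set (formula L ('I_n + U))) : Prop :=
  finitely_satisfiable_in id setT p /\ (forall phi, p phi \/ p (Neg phi)).

(* An L(A)-formula seen as an L(B)-formula along e : A -> B. *)
Definition push_params (L : language) (X A B : Type) (e : A -> B)
    (phi : formula L (X + A)) : formula L (X + B) :=
  rename (fun z => match z with inl x => inl x | inr a => inr (e a) end) phi.

(* The translate g.p: phi(x) is in g.p iff phi(g.x), that is
   "exists z, mu(g, x, z) /\ phi(z)", is in p.  That formula is specified up to
   equivalence in [U] by the set it defines. *)
Definition translate (L : language) (U : structure L) (A : Type) (n : nat)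
    (c : A -> U) (mu : formula L ('I_n + 'I_n + 'I_n + A)) (g : 'I_n -> U)
    (p : set (formula L ('I_n + U))) : set (formula L ('I_n + U)) :=
  [set phi | exists2 psi, p psi &
     defset id psi = [set a | exists2 d, graph c mu g a d & defset id phi d]].

(* [U] is meant to be a monster model whose small sets have size < |K|. *)
Definition fsg (K : Type) (L : language) (U : structure L) (n : nat)
    (G : set ('I_n -> U)) (R : ('I_n -> U) -> ('I_n -> U) -> ('I_n -> U) -> Prop)
    : Prop :=
  exists (p : set (formula L ('I_n + U))) (M1 : structure L) (e : M1 -> U)
         (pi : set (formula L ('I_n + M1)))
         (mu : formula L ('I_n + 'I_n + 'I_n + M1)),
    [/\ card_lt M1 K /\ elementary e,
        type_definable_group e pi mu G R,
        complete_type p,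
        (forall phi, pi phi -> p (push_params e phi)) &
        forall g, G g ->
          finitely_satisfiable_in id
            (G `&` [set a | exists a1 : 'I_n -> M1, a = e \o a1])
            (translate e mu g p)].

Definition externally_definable (L : language) (M N : structure L) (e : M -> N)
    (n : nat) (X : set ('I_n -> M)) : Prop :=
  exists (m : nat) (phi : formula L ('I_n + 'I_m)) (d : 'I_m -> N),
    X = [set a | sat (env (e \o a) d) phi].

Definition shelah_language (L : language) (M N : structure L) (e : M -> N)
    : language :=
  @Language (fun_sym L)
    (rel_sym L +
       {n : nat & {X : set ('I_n -> M) | externally_definable e X}})%type
    (@fun_arity L)
    (fun r => match r with inl r0 => rel_arity r0 | inr s => projT1 s end).

(* The Shelah expansion of [M], computed in the elementary extension [N]. *)
Definition shelah (L : language) (M N : structure L) (e : M -> N)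
    : structure (shelah_language e) :=
  @Structure (shelah_language e) M (carrier_inhabited M)
    (@fun_int L M)
    (fun r : rel_sym (shelah_language e) =>
       match r return ('I_(@rel_arity (shelah_language e) r) -> M) -> Prop with
       | inl r0 => fun a => @rel_int L M r0 a
       | inr s => fun a => proj1_sig (projT2 s) a
       end).

Definition reduct (L : language) (M N : structure L) (e : M -> N)
    (S : structure (shelah_language e)) : structure L :=
  @Structure L S (carrier_inhabited S)
    (fun (f : fun_sym L) a => @fun_int (shelah_language e) S f a)
    (fun (r : rel_sym L) a => @rel_int (shelah_language e) S (inl r) a).

(* Main.v *)
Require Import Defs.
From mathcomp Require Import all_boot.
From mathcomp Require Import boolp classical_sets functions cardinality filter.
Set Implicit Arguments.
Unset Strict Implicit.
Unset Printing Implicit Defensive.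
Local Open Scope classical_set_scope.
Local Open Scope card_scope.

(** Write [G] for the group and [G(M)] for its points in [M].

    Why [G] is definable.  Quantifier elimination for the Shelah expansion makes
    [G(M)] externally definable.  In a NIP theory an externally definable set
    [X] has an honest definition: a single formula [theta(x, z)] such that every
    finite subset of [X] is contained in an instance of [theta] over [M] which
    is itself contained in [X] ([honest_definition]).  An instance contained in
    [G(M)] is contained in [G], because [M] is saturated over the parameters of
    the partial type defining [G].  So it is enough that some finite set of
    points of [G(M)] forces every instance of [theta] that contains it to be
    generic, that is to cover [G] by finitely many right translates; then [G] is
    a finite union of translates of a definable subset, hence definable.  Such
    finite sets exist for all formulas by fsg ([uniform_test_points]): if an
    instance of a formula contains all of [G(M1)], it belongs to the generic type
    [p], all translates of which are finitely satisfiable in [G(M1)], so every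
    translate of the instance meets [G(M1)]; compactness replaces [G(M1)] by a
    finite part of it, and an automorphism over [M0] carries that part into [M].

    Why [G] is fsg in the theory of the expansion.  The same argument applies to
    finitely many formulas at once: among the members of a definable cover of
    finitely many well chosen points of [G(M)], one is generic.  The points do
    not depend on the parameters of the cover, so that external parameters are
    harmless and the statement holds in the expansion and, being first-order,
    in its elementary extensions ([shelah_cover_generic]).  Hence the
    complements of the non-generic definable sets have the finite intersection
    property, and any complete type containing them witnesses fsg
    ([fsg_of_cover_generic]).

    Why honest definitions exist ([honest_definition]).  Call a subset of [X]
    small when the instances of one formula that lie inside [X] capture all its
    finite subsets.  Small sets form an ideal; if [X] were not small, some
    ultrafilter [D] on [X] would avoid it.  Then any definable property of
    sequences which is large for the iterated ultrafilter holds on a sequence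
    whose membership in [X] follows a prescribed pattern ([large_meets_pattern]).
    By NIP, for long sequences some pattern is almost surely not cut out by any
    parameter of [M], although [X] itself cuts it out on some such sequence;
    this contradicts [M] being elementary in the monster model.  Projecting
    honest definitions gives quantifier elimination ([external_proj],
    [shelah_external]). *)

(** * Variables, parameters and renaming *)

Lemma exists_choice (X : Type) (Y : X -> Type) (P : forall x, Y x -> Prop) :
  (forall x, exists y, P x y) -> exists f, forall x, P x (f x).
Proof. by move=> H; exists (fun x => projT1 (cid (H x))) => x; case: cid. Qed.

Lemma comp_env X Y (S S' : Type) (h : S -> S') (f : X -> S) (g : Y -> S) :
  h \o env f g = env (h \o f) (h \o g).
Proof. by apply/funext; case. Qed.

Lemma eval_rename (L : language) (S : structure L) V W (f : V -> W)
    (t : term L V) (rho : W -> S) :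
  eval rho (term_rename f t) = eval (rho \o f) t.
Proof. by elim: t => //= s args IH; congr fun_int; apply/funext. Qed.

Lemma sat_rename (L : language) (S : structure L) V W (f : V -> W)
    (phi : formula L V) (rho : W -> S) :
  sat rho (rename f phi) <-> sat (rho \o f) phi.
Proof.
elim: phi W f rho => /= [|{}V t u|{}V r args|{}V p IHp q IHq|{}V p IH] W f rho //.
- by rewrite !eval_rename.
- suff -> : (fun i => eval rho (term_rename f (args i))) =
            (fun i => eval (rho \o f) (args i)) by [].
  by apply/funext => i; rewrite eval_rename.
- by rewrite IHp IHq.
- suff E a : oapp rho a \o omap f = oapp (rho \o f) a.
    by split=> H a; have := H a; rewrite IH E.
  by apply/funext; case.
Qed.

Lemma sat_eq (L : language) (S : structure L) V (phi : formula L V)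
    (rho rho' : V -> S) : rho = rho' -> sat rho phi <-> sat rho' phi.
Proof. by move=> ->. Qed.

(** Types of variables and of parameters may be infinite, but elementarity and
    saturation speak of finite tuples.  This is how formulas are brought down to
    finite tuples of parameters, uniformly in all structures. *)
Definition finitely_parametrized (L : language) (X A : Type)
    (P : forall S : structure L, (X -> S) -> (A -> S) -> Prop) : Prop :=
  exists (W : finType) (b : W -> A) (psi : formula L (X + W)),
    forall S x c, P S x c <-> sat (env x (c \o b)) psi.

Lemma common_parameters (A : Type) (I : finType) (W : I -> finType)
    (b : forall i, W i -> A) :
  exists (W' : finType) (b' : W' -> A) (s : forall i, W i -> W'),
    forall i, b' \o s i = b i.
Proof.
by exists {i : I & W i}, (fun u => b (tag u) (tagged u)), (fun i w => Tagged W w).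
Qed.

Lemma term_fin_params (L : language) (X A V : Type) (f : V -> X + A)
    (t : term L V) :
  exists (W : finType) (b : W -> A) (t1 : term L (X + W)),
    forall (S : structure L) (x : X -> S) (c : A -> S),
      eval (env x c \o f) t = eval (env x (c \o b)) t1.
Proof.
elim: t => [v|s args IH].
  case E: (f v) => [x|a].
    exists void, (of_void A), (Var L (inl x)) => S y c /=.
    by rewrite E.
  exists unit, (fun=> a), (Var L (inr tt)) => S y c /=.
  by rewrite E.
have [W /exists_choice[b /exists_choice[t1 H]]] := exists_choice IH.
have [W' [b' [r Hb]]] := common_parameters b.
exists W', b', (App (fun i => term_rename
  (fun z => match z with inl x => inl x | inr w => inr (r i w) end) (t1 i))).
move=> S x c /=; congr fun_int; apply/funext => i; rewrite H eval_rename.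
by congr eval; apply/funext; case=> //= w; rewrite -Hb.
Qed.

Lemma formula_fin_params (L : language) (X A V : Type) (f : V -> X + A)
    (phi : formula L V) :
  finitely_parametrized (fun (S : structure L) x c => sat (env x c \o f) phi).
Proof.
elim: phi X f => {V} [V|V t u|V r args|V p IHp q IHq|V p IH] X f.
- by exists void, (of_void A), Bot.
- have [W1 [b1 [t1 H1]]] := term_fin_params f t.
  have [W2 [b2 [t2 H2]]] := term_fin_params f u.
  exists (W1 + W2)%type, (env b1 b2), (Eq
   (term_rename (fun z => match z with inl x => inl x | inr w => inr (inl w) end) t1)
   (term_rename (fun z => match z with inl x => inl x | inr w => inr (inr w) end) t2)).
  move=> S x c /=; rewrite H1 H2 !eval_rename.
  rewrite (_ : _ \o _ = env x (c \o b1)); last by apply/funext; case.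
  by rewrite (_ : _ \o _ = env x (c \o b2)); last by apply/funext; case.
- have [W /exists_choice[b /exists_choice[t1 H]]] := exists_choice (fun i => term_fin_params f (args i)).
  have [W' [b' [s Hb]]] := common_parameters b.
  exists W', b', (Atom (fun i => term_rename
    (fun z => match z with inl x => inl x | inr w => inr (s i w) end) (t1 i))).
  move=> S x c /=.
  suff -> : (fun i => eval (env x c \o f) (args i)) = 
    (fun i => eval (env x (c \o b')) (term_rename
    (fun z => match z with inl x => inl x | inr w => inr (s i w) end) (t1 i))) by [].
  apply/funext => i; rewrite H eval_rename.
  by congr eval; apply/funext; case=> //= w; rewrite -Hb.
- have [W1 [b1 [t1 H1]]] := IHp _ f.
  have [W2 [b2 [t2 H2]]] := IHq _ f.
  exists (W1 + W2)%type, (env b1 b2), (Imp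
   (rename (fun z => match z with inl x => inl x | inr w => inr (inl w) end) t1)
   (rename (fun z => match z with inl x => inl x | inr w => inr (inr w) end) t2)).
  move=> S x c /=; rewrite H1 H2 !sat_rename.
  rewrite (_ : _ \o _ = env x (c \o b1)); last by apply/funext; case.
  by rewrite (_ : _ \o _ = env x (c \o b2)); last by apply/funext; case.
- pose f' (o : option V) : option X + A :=
    if o is Some v then match f v with inl x => inl (Some x) | inr a => inr a end
    else inl None.
  have [W [b [psi H]]] := IH _ f'.
  exists W, b, (All (rename (fun z => match z with
     | inl (Some x) => Some (inl x) | inl None => None
     | inr w => Some (inr w) end) psi)).
  move=> S x c /=.
  suff E a : sat (oapp (env x c \o f) a) p <-> sat (oapp (env x (c \o b)) a)
      (rename (fun z => match z with
     | inl (Some x) => Some (inl x) | inl None => None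
     | inr w => Some (inr w) end) psi) by split=> h a; apply/E/h.
  have := H S (oapp x a) c; rewrite sat_rename.
  rewrite (_ : env (oapp x a) c \o f' = oapp (env x c \o f) a); last first.
    by apply/funext; case=> //= v; case: (f v).
  move=> ->; rewrite (_ : _ \o _ = env (oapp x a) (c \o b)) //.
  by apply/funext; case=> //=; case.
Qed.

Lemma fin_params (L : language) (X A : Type) (phi : formula L (X + A)) :
  finitely_parametrized (fun (S : structure L) x c => sat (env x c) phi).
Proof. exact: (formula_fin_params id phi). Qed.

Lemma fin_params_family (L : language) (X A : Type) (I : finType)
    (phi : I -> formula L (X + A)) :
  exists (W : finType) (b : W -> A) (psi : I -> formula L (X + W)),
    forall i (S : structure L) (x : X -> S) c,
      sat (env x c) (phi i) <-> sat (env x (c \o b)) (psi i).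
Proof.
have [W /exists_choice[b /exists_choice[psi H]]] := exists_choice (fun i => fin_params (phi i)).
have [W' [b' [s Hb]]] := common_parameters b.
exists W', b', (fun i => rename
  (fun z => match z with inl x => inl x | inr w => inr (s i w) end) (psi i)).
move=> i S x c; rewrite H sat_rename.
by rewrite (_ : _ \o _ = env x (c \o b i)) //; apply/funext; case=> //= w; rewrite -Hb.
Qed.

(** * Definable sets *)

Fixpoint allI (L : language) m : forall X : Type, formula L (X + 'I_m) -> formula L X :=
  match m with
  | 0 => fun X phi => rename (fun z : X + 'I_0 => match z with
           | inl x => x
           | inr i => False_rect X (notF (ltn_ord i)) end) phi
  | m'.+1 => fun X phi => All (allI (rename (fun z : X + 'I_m'.+1 =>
       match z with
       | inl x => inl (Some x)
       | inr i => match unlift ord0 i with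
                  | None => inl None | Some j => inr j end
       end) phi))
  end.

Lemma sat_allI (L : language) (S : structure L) m (X : Type) (phi : formula L (X + 'I_m))
    (rho : X -> S) :
  sat rho (allI phi) <-> forall a, sat (env rho a) phi.
Proof.
elim: m X phi rho => [|m IH] X phi rho /=.
  rewrite sat_rename; have [s0] := carrier_inhabited S.
  split=> [H a|/(_ (fun=> s0))]; last first.
    by congr sat; apply/funext; case=> // -[].
  by move: H; congr sat; apply/funext; case=> // -[].
split=> [H a|H a0].
  move/IH: (H (a ord0)) => /(_ (a \o lift ord0)); rewrite sat_rename.
  congr sat; apply/funext; case=> //= i.
  by case: unliftP => [j ->|->].
rewrite IH => a'; rewrite sat_rename.
have := H (fun i => oapp a' a0 (unlift ord0 i)).
congr sat; apply/funext; case=> //= i.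
by case: unliftP.
Qed.

Section Codefinable.
Variables (L : language) (S1 S2 : structure L) (A : Type).
Variables (c1 : A -> S1) (c2 : A -> S2).

(** Two relations on two structures are codefinable when one formula defines
    both of them, its parameters being read through [c1] and [c2].  With two
    equal families this is definability; with two structures one of which is
    an elementary extension of the other, it is what allows a statement to be
    transferred ([codef_transfer]).  Definability proofs then follow the shape of
    the statement, and no formula needs to be written down. *)
Definition codef V (P1 : (V -> S1) -> Prop) (P2 : (V -> S2) -> Prop) : Prop :=
  exists phi : formula L (V + A),
    (forall v, P1 v <-> sat (env v c1) phi) /\
    (forall v, P2 v <-> sat (env v c2) phi).

(** The tuples that can be substituted for the variables of a formula: their
    entries are variables or parameters, the same ones in both structures. *)
Definition cotuple V X (t1 : (V -> S1) -> X -> S1) (t2 : (V -> S2) -> X -> S2)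
    : Prop :=
  exists f : X -> V + A,
    (forall v, t1 v = env v c1 \o f) /\ (forall v, t2 v = env v c2 \o f).

Lemma cotuple_id V : cotuple (fun v : V -> S1 => v) (fun v : V -> S2 => v).
Proof. by exists inl. Qed.

Lemma cotuple_var V X (f : X -> V) :
  cotuple (fun v x => v (f x)) (fun v x => v (f x)).
Proof. by exists (inl \o f). Qed.

Lemma cotuple_par V X (f : X -> A) :
  cotuple (fun (_ : V -> S1) x => c1 (f x)) (fun (_ : V -> S2) x => c2 (f x)).
Proof. by exists (inr \o f). Qed.

Lemma cotuple_params V : cotuple (fun _ : V -> S1 => c1) (fun _ : V -> S2 => c2).
Proof. by exists inr. Qed.

Lemma cotuple_env V X Y (t1 : (V -> S1) -> X -> S1) t2
    (u1 : (V -> S1) -> Y -> S1) u2 :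
  cotuple t1 t2 -> cotuple u1 u2 ->
  cotuple (fun v => env (t1 v) (u1 v)) (fun v => env (t2 v) (u2 v)).
Proof.
move=> [f [f1 f2]] [g [g1 g2]].
exists (fun z => match z with inl x => f x | inr y => g y end).
by split=> v; rewrite ?(f1, f2) ?(g1, g2); apply/funext; case.
Qed.

Lemma cotuple_comp V X Y (g : Y -> X) (t1 : (V -> S1) -> X -> S1) t2 :
  cotuple t1 t2 -> cotuple (fun v y => t1 v (g y)) (fun v y => t2 v (g y)).
Proof.
move=> [f [f1 f2]]; exists (f \o g).
by split=> v; apply/funext => y; rewrite ?(f1, f2).
Qed.

Lemma codef_iff V (P1 Q1 : (V -> S1) -> Prop) (P2 Q2 : (V -> S2) -> Prop) :
  (forall v, P1 v <-> Q1 v) -> (forall v, P2 v <-> Q2 v) ->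
  codef Q1 Q2 -> codef P1 P2.
Proof.
move=> E1 E2 [phi [H1 H2]]; exists phi; split=> v; first by rewrite E1.
by rewrite E2.
Qed.

Lemma codef_sat V X (phi : formula L X) (t1 : (V -> S1) -> X -> S1) t2 :
  cotuple t1 t2 -> codef (fun v => sat (t1 v) phi) (fun v => sat (t2 v) phi).
Proof.
move=> [f [f1 f2]]; exists (rename f phi).
by split=> v; rewrite sat_rename (f1, f2).
Qed.

Lemma codef_defset V X (phi : formula L (X + A)) (t1 : (V -> S1) -> X -> S1) t2 :
  cotuple t1 t2 ->
  codef (fun v => defset c1 phi (t1 v)) (fun v => defset c2 phi (t2 v)).
Proof.
by move=> ?; apply: codef_sat; apply: cotuple_env => //; apply: cotuple_params.
Qed.

Lemma codef_graph V n (mu : formula L ('I_n + 'I_n + 'I_n + A))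
    (r1 s1 t1 : (V -> S1) -> 'I_n -> S1) r2 s2 t2 :
  cotuple r1 r2 -> cotuple s1 s2 -> cotuple t1 t2 ->
  codef (fun v => graph c1 mu (r1 v) (s1 v) (t1 v))
        (fun v => graph c2 mu (r2 v) (s2 v) (t2 v)).
Proof.
move=> ? ? ?; apply: codef_sat; apply: cotuple_env; last exact: cotuple_params.
by do 2 apply: cotuple_env => //.
Qed.

Lemma codef_imp V (P1 Q1 : (V -> S1) -> Prop) (P2 Q2 : (V -> S2) -> Prop) :
  codef P1 P2 -> codef Q1 Q2 ->
  codef (fun v => P1 v -> Q1 v) (fun v => P2 v -> Q2 v).
Proof.
move=> [p [p1 p2]] [q [q1 q2]]; exists (Imp p q).
by split=> v /=; rewrite ?(p1, p2) ?(q1, q2).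
Qed.

Lemma codef_const V (B : Prop) : codef (fun _ : V -> S1 => B) (fun _ : V -> S2 => B).
Proof.
have [b|b] := EM B; last by exists Bot; split=> v /=; split.
by exists (Imp Bot Bot); split=> v /=; split.
Qed.

Lemma codef_all V (W : finType) (Q1 : (V -> S1) -> (W -> S1) -> Prop)
    (Q2 : (V -> S2) -> (W -> S2) -> Prop) :
  codef (fun u => Q1 (fun x : V => u (inl x)) (fun w : W => u (inr w)))
        (fun u => Q2 (fun x : V => u (inl x)) (fun w : W => u (inr w))) ->
  codef (fun v => forall w, Q1 v w) (fun v => forall w, Q2 v w).
Proof.
move=> [phi [H1 H2]].
pose psi := rename (fun z => match z with
  | inl (inl v) => inl (inl v)
  | inl (inr w) => inr (enum_rank w)
  | inr a => inl (inr a) end) phi.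
have E (S : structure L) (c : A -> S) (v : V -> S) :
    sat (env v c) (allI psi) <-> forall w : W -> S, sat (env (env v w) c) phi.
  rewrite sat_allI; split=> H a.
    have := H (a \o enum_val); rewrite sat_rename; congr sat.
    by apply/funext; case=> // -[] //= w; rewrite enum_rankK.
  rewrite sat_rename; have := H (a \o enum_rank); congr sat.
  by apply/funext; case=> // -[].
exists (allI psi); split=> v; rewrite E.
- by split=> H w; [apply/(H1 (env v w))|apply/(H1 (env v w))]; apply: H.
- by split=> H w; [apply/(H2 (env v w))|apply/(H2 (env v w))]; apply: H.
Qed.

Lemma codef_not V (P1 : (V -> S1) -> Prop) (P2 : (V -> S2) -> Prop) :
  codef P1 P2 -> codef (fun v => ~ P1 v) (fun v => ~ P2 v).
Proof. by move=> H; apply: codef_imp => //; apply: codef_const. Qed.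

Lemma codef_and V (P1 Q1 : (V -> S1) -> Prop) (P2 Q2 : (V -> S2) -> Prop) :
  codef P1 P2 -> codef Q1 Q2 ->
  codef (fun v => P1 v /\ Q1 v) (fun v => P2 v /\ Q2 v).
Proof.
move=> P Q; apply: (codef_iff (Q1 := fun v => ~ (P1 v -> ~ Q1 v))
                              (Q2 := fun v => ~ (P2 v -> ~ Q2 v))).
- by move=> v; rewrite not_implyE notK.
- by move=> v; rewrite not_implyE notK.
- by apply: codef_not; apply: codef_imp => //; apply: codef_not.
Qed.

Lemma codef_or V (P1 Q1 : (V -> S1) -> Prop) (P2 Q2 : (V -> S2) -> Prop) :
  codef P1 P2 -> codef Q1 Q2 ->
  codef (fun v => P1 v \/ Q1 v) (fun v => P2 v \/ Q2 v).
Proof.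
move=> P Q; apply: (codef_iff (Q1 := fun v => ~ P1 v -> Q1 v)
                              (Q2 := fun v => ~ P2 v -> Q2 v)).
- by move=> v; split=> [[]//|H]; have [|/H] := EM (P1 v); [left|right].
- by move=> v; split=> [[]//|H]; have [|/H] := EM (P2 v); [left|right].
- by apply: codef_imp => //; apply: codef_not.
Qed.

Lemma codef_equiv V (P1 Q1 : (V -> S1) -> Prop) (P2 Q2 : (V -> S2) -> Prop) :
  codef P1 P2 -> codef Q1 Q2 ->
  codef (fun v => P1 v <-> Q1 v) (fun v => P2 v <-> Q2 v).
Proof. by move=> P Q; apply: codef_and; apply: codef_imp. Qed.

Lemma codef_ex V (W : finType) (Q1 : (V -> S1) -> (W -> S1) -> Prop)
    (Q2 : (V -> S2) -> (W -> S2) -> Prop) :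
  codef (fun u => Q1 (fun x : V => u (inl x)) (fun w : W => u (inr w)))
        (fun u => Q2 (fun x : V => u (inl x)) (fun w : W => u (inr w))) ->
  codef (fun v => exists w, Q1 v w) (fun v => exists w, Q2 v w).
Proof.
move=> H; apply: (codef_iff (Q1 := fun v => ~ forall w, ~ Q1 v w)
                            (Q2 := fun v => ~ forall w, ~ Q2 v w)).
- by move=> v; apply: not_existsP.
- by move=> v; apply: not_existsP.
- by apply: codef_not; apply: codef_all; apply: codef_not.
Qed.

Lemma codef_ex2 V (W : finType) (P1 Q1 : (V -> S1) -> (W -> S1) -> Prop)
    (P2 Q2 : (V -> S2) -> (W -> S2) -> Prop) :
  codef (fun u => P1 (fun x : V => u (inl x)) (fun w : W => u (inr w)))
        (fun u => P2 (fun x : V => u (inl x)) (fun w : W => u (inr w))) ->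
  codef (fun u => Q1 (fun x : V => u (inl x)) (fun w : W => u (inr w)))
        (fun u => Q2 (fun x : V => u (inl x)) (fun w : W => u (inr w))) ->
  codef (fun v => exists2 w, P1 v w & Q1 v w)
        (fun v => exists2 w, P2 v w & Q2 v w).
Proof.
move=> P Q; apply: (codef_iff (Q1 := fun v => exists w, P1 v w /\ Q1 v w)
                              (Q2 := fun v => exists w, P2 v w /\ Q2 v w)).
- by move=> v; split=> [[w ? ?]|[w [? ?]]]; exists w.
- by move=> v; split=> [[w ? ?]|[w [? ?]]]; exists w.
- by apply: codef_ex; apply: codef_and.
Qed.

Lemma codef_forall_fin V (I : finType) (P1 : I -> (V -> S1) -> Prop)
    (P2 : I -> (V -> S2) -> Prop) :
  (forall i, codef (P1 i) (P2 i)) ->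
  codef (fun v => forall i, P1 i v) (fun v => forall i, P2 i v).
Proof.
move=> H.
have {H} : forall s : seq I, codef (fun v => forall i, i \in s -> P1 i v)
                                   (fun v => forall i, i \in s -> P2 i v).
  elim=> [|i s IH].
    by apply: codef_iff (codef_const V True) => v; split.
  apply: codef_iff (codef_and (H i) IH) => v.
  - split=> [h|[h1 h2] k].
      by split=> [|k ks]; apply: h; rewrite inE ?eqxx ?ks ?orbT.
    by rewrite inE => /orP[/eqP->|/h2].
  - split=> [h|[h1 h2] k].
      by split=> [|k ks]; apply: h; rewrite inE ?eqxx ?ks ?orbT.
    by rewrite inE => /orP[/eqP->|/h2].
move=> /(_ (enum I)); apply: codef_iff => v.
- by split=> h i *; apply: h; rewrite ?mem_enum.
- by split=> h i *; apply: h; rewrite ?mem_enum.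
Qed.

Lemma codef_exists_fin V (I : finType) (P1 : I -> (V -> S1) -> Prop)
    (P2 : I -> (V -> S2) -> Prop) :
  (forall i, codef (P1 i) (P2 i)) ->
  codef (fun v => exists i, P1 i v) (fun v => exists i, P2 i v).
Proof.
move=> H.
have : codef (fun v => ~ forall i, ~ P1 i v) (fun v => ~ forall i, ~ P2 i v).
  by apply: codef_not; apply: codef_forall_fin => i; apply: codef_not.
apply: codef_iff => v.
- exact: not_existsP.
- exact: not_existsP.
Qed.

Lemma codef_eq V (X : finType) (t1 u1 : (V -> S1) -> X -> S1) t2 u2 :
  cotuple t1 t2 -> cotuple u1 u2 ->
  codef (fun v => t1 v = u1 v) (fun v => t2 v = u2 v).
Proof.
move=> [f [f1 f2]] [g [g1 g2]].
have : codef (fun v => forall x, env v c1 (f x) = env v c1 (g x))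
             (fun v => forall x, env v c2 (f x) = env v c2 (g x)).
  by apply: codef_forall_fin => x; exists (Eq (Var L (f x)) (Var L (g x))).
apply: codef_iff => v; rewrite ?(f1, f2) ?(g1, g2).
- by split=> [/funeqP//|h]; apply/funext.
- by split=> [/funeqP//|h]; apply/funext.
Qed.

End Codefinable.

Notation definable c P := (codef c c P P).

Ltac cotuple_tac :=
  first [ assumption | exact: cotuple_id | exact: cotuple_var | exact: cotuple_par | exact: cotuple_params
        | apply: cotuple_env; cotuple_tac
        | apply: cotuple_comp; assumption ].

Ltac codef_tac :=
  first [ assumption
        | apply: codef_const
        | apply: codef_defset; cotuple_tac
        | apply: codef_graph; cotuple_tac
        | apply: codef_sat; cotuple_tac
        | apply: codef_eq; cotuple_tac
        | apply: codef_all; codef_tac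
        | apply: codef_ex2; codef_tac
        | apply: codef_ex; codef_tac
        | apply: codef_forall_fin => ?; codef_tac
        | apply: codef_exists_fin => ?; codef_tac
        | apply: codef_equiv; codef_tac
        | apply: codef_and; codef_tac
        | apply: codef_or; codef_tac
        | apply: codef_not; codef_tac
        | apply: codef_imp; codef_tac ].

Lemma elementary_sat (L : language) (S1 S2 : structure L) (e : S1 -> S2) V
    (phi : formula L V) (rho : V -> S1) :
  elementary e -> sat rho phi <-> sat (e \o rho) phi.
Proof.
move=> he.
have [W [b [psi H]]] := formula_fin_params (@inr void V) phi.
have E (S : structure L) (r : V -> S) : sat r phi <->
    sat (r \o b \o enum_val) (rename (fun z : void + W => match z with
       | inl x => of_void _ x | inr w => enum_rank w end) psi).
  rewrite sat_rename (_ : _ \o _ = env (of_void S) (r \o b)); last first.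
    by apply/funext; case=> //= w; rewrite enum_rankK.
  by rewrite -H; apply: sat_eq; apply/funext.
by rewrite !E he.
Qed.

Lemma codef_void (L : language) (S1 S2 : structure L) V
    (P1 : (V -> S1) -> Prop) (P2 : (V -> S2) -> Prop) :
  codef (of_void S1) (of_void S2) P1 P2 ->
  exists phi : formula L V,
    (forall v, P1 v <-> sat v phi) /\ (forall v, P2 v <-> sat v phi).
Proof.
move=> [phi [H1 H2]].
exists (rename (fun z => match z with inl v => v | inr a => of_void V a end) phi).
by split=> v; rewrite (H1, H2) sat_rename; apply: sat_eq; apply/funext; case.
Qed.

Lemma codef_transfer (L : language) (S1 S2 : structure L) (A : Type)
    (c : A -> S1) (e : S1 -> S2) V (P1 : (V -> S1) -> Prop) P2 (v : V -> S1) :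
  elementary e -> codef c (e \o c) P1 P2 -> P1 v <-> P2 (e \o v).
Proof.
move=> he [phi [H1 H2]]; rewrite H1 H2 (elementary_sat _ _ he) comp_env.
by [].
Qed.

Lemma sat_automorphism (L : language) (S : structure L) (s : S -> S) V
    (phi : formula L V) (rho : V -> S) :
  automorphism s -> sat rho phi <-> sat (s \o rho) phi.
Proof.
move=> [bs hf hr]; have hev W (t : term L W) r : s (eval r t) = eval (s \o r) t.
  by elim: t => //= f args IH; rewrite hf; congr fun_int; apply/funext => i /=.
elim: phi rho => {V} [V|V t u|V r args|V p IHp q IHq|V p IH] rho //=.
- by rewrite -!hev; split=> [->//|]; apply: (bij_inj bs).
- rewrite hr (_ : s \o _ = (fun i => eval (s \o rho) (args i))) //.
  by apply/funext => i /=; rewrite hev.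
- by rewrite IHp IHq.
- have E a : s \o oapp rho a = oapp (s \o rho) (s a) by apply/funext; case.
  have [s' sK s'K] := bs; split=> H a.
    by have := H (s' a); rewrite IH E s'K.
  by rewrite IH E.
Qed.

(** * Small parameter sets and saturation *)

Lemma card_leT_inj (A B : Type) :
  [set: A] #<= [set: B] <-> exists f : A -> B, injective f.
Proof.
split=> [/card_leP[f]|[f finj]].
  exists (fun a => val (f (SigSub (mem_setT a)))) => a b /val_inj E.
  have /(congr1 val) := inj (in_setT _) (in_setT _) E.
  by [].
rewrite -(card_le_eql (inj_card_eq (f := f) _)); last by move=> a b _ _; apply: finj.
exact: subset_card_le.
Qed.

Lemma card_lt_le (A B K : Type) :
  [set: A] #<= [set: B] -> card_lt B K -> card_lt A K.
Proof. by move=> AB; apply: contra => /card_le_trans; apply. Qed.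

Lemma card_leT_nat_sum (A B : Type) (f : nat -> A) (g : B -> nat) m :
  injective f -> injective g -> (forall b, g b < m) ->
  [set: A + B] #<= [set: A].
Proof.
move=> finj ginj gm; apply/card_leT_inj.
(* Hilbert's hotel: the guests f n move to f (m + n). *)
have [h [hf hN]] : exists h : A -> A, (forall n, h (f n) = f (m + n)) /\
    (forall a, ~ (exists n, f n = a) -> h a = a).
  have := exists_choice (P := fun a b : A => (forall n, f n = a -> b = f (m + n)) /\
     (~ (exists n, f n = a) -> b = a)).
  case=> [a|h hP].
    have [[n <-]|nfa] := EM (exists n, f n = a).
      by exists (f (m + n)); split=> [k /finj->//|[]]; exists n.
    by exists a; split=> // n fn; case: nfa; exists n.
  by exists h; split=> a; [apply: (hP _).1|apply: (hP _).2].
have hout a n : h a = f n -> ~ (n < m).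
  have [[k <-]|nfa] := EM (exists n, f n = a).
    by rewrite hf => /finj <-; rewrite ltnNge leq_addr.
  by rewrite hN // => E; case: nfa; exists n.
exists (fun z => match z with inl a => h a | inr b => f (g b) end).
move=> [a|b] [a'|b'] //=; last by move=> /finj /ginj ->.
- have [[k <-]|nfa] := EM (exists n, f n = a); have [[k' <-]|nfa'] := EM (exists n, f n = a').
  + by rewrite !hf => /finj /addnI ->.
  + by rewrite hf hN // => E; case: nfa'; exists (m + k).
  + by rewrite hf hN // => E; case: nfa; exists (m + k').
  + by rewrite !hN // => ->.
- by move=> /hout; rewrite gm.
- by move=> /esym /hout; rewrite gm.
Qed.

Section Small.
Variables (L : language) (K : Type).
Hypothesis hK : card_lt (formula L nat) K.

Lemma countable_small (A : Type) : [set: A] #<= [set: nat] -> card_lt A K.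
Proof.
move=> hA; apply: (card_lt_le hA); apply: card_lt_le hK; apply/card_leT_inj.
by exists (fun n => Eq (Var L n) (Var L n)) => m n [].
Qed.

Lemma small_sum (A : Type) (B : finType) : card_lt A K -> card_lt (A + B) K.
Proof.
move=> hA; have [infA|finA] := EM (infinite_set [set: A]).
  have /card_leT_inj[f finj] : [set: nat] #<= [set: A] by apply/infiniteP.
  apply: (card_lt_le _ hA).
  apply: (card_leT_nat_sum (m := #|B|) (g := fun b => val (enum_rank b)) finj).
    by move=> b b' /val_inj /enum_rank_inj.
  by move=> b; apply: ltn_ord.
apply: countable_small; have : finite_set [set: A] by apply: contrapT.
move=> /finite_set_countable /card_leT_inj[f finj].
apply/card_leT_inj; exists (fun z => pickle (match z with
  inl a => inl (f a) | inr b => inr b end : nat + B)).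
by move=> [a|b] [a'|b'] /(pcan_inj pickleK) [] // => [/finj ->|->].
Qed.

End Small.

Lemma elementary_inj (L : language) (S1 S2 : structure L) (e : S1 -> S2) :
  elementary e -> injective e.
Proof.
move=> he a b eab.
have /= H := elementary_sat (Eq (Var L true) (Var L false))
  (fun x : bool => if x then a else b) he.
by apply/H.
Qed.

Lemma elementary_card (L : language) (S1 S2 : structure L) (e : S1 -> S2) K :
  elementary e -> card_lt S2 K -> card_lt S1 K.
Proof.
move=> /elementary_inj einj; apply: card_lt_le; apply/card_leT_inj.
by exists e.
Qed.

Lemma finite_set_family (T : Type) (F : set T) :
  finite_set F <-> exists l (f : 'I_l -> T), F = range f.
Proof.
split=> [fF|[l [f ->]]]; last exact: finite_image.
have /finite_seqP[s sF] := (fF : finite_set (F : set {classic T})).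
exists (size s), (tnth (in_tuple s)); rewrite sF; apply/seteqP; split=> x /=.
  by move=> xs; have /tnthP[t ->] : x \in in_tuple s by []; exists t.
by move=> [t _ <-]; apply: (mem_tnth t (in_tuple s)).
Qed.

(** Saturation for definable sets rather than formulas, in any finite tuple of
    variables; the index type [J] of the family is arbitrary. *)
Lemma realize_definable (L : language) (S : structure L) (A : Type) (c : A -> S)
    (V : finType) (J : Type) (P : J -> (V -> S) -> Prop) :
  realizes_types_over c -> (forall t, definable c (P t)) ->
  (forall l (f : 'I_l -> J), exists v, forall t, P (f t) v) ->
  exists v, forall t, P t v.
Proof.
move=> hreal /exists_choice[phi Hphi] fip.
pose r (z : V + A) : 'I_#|V| + A :=
  match z with inl v => inl (enum_rank v) | inr a => inr a end.
have Hr t (a : 'I_#|V| -> S) :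
    defset c (rename r (phi t)) a <-> P t (a \o enum_rank).
  rewrite (Hphi t).1 /defset /= sat_rename; apply: sat_eq.
  by apply/funext; case.
have [|a Ha] := hreal #|V| (range (fun t => rename r (phi t))).
  move=> F /finite_set_family[l [f ->]] sub.
  have /exists_choice[g Hg] t : exists i, rename r (phi i) = f t.
    by have [i _ E] := sub (f t) (ex_intro2 _ _ t I erefl); exists i.
  have [v Hv] := fip l g.
  exists (v \o enum_val) => // _ [t _ <-]; rewrite -Hg; apply/Hr.
  by rewrite (_ : _ \o _ = v) //; apply/funext => x /=; rewrite enum_rankK.
exists (a \o enum_rank) => t; apply/Hr; apply: Ha.
by exists t.
Qed.

Section Monster.
Variables (L : language) (K : Type) (U : structure L).
Hypothesis hU : monster K U.

Lemma monster_realize (A : Type) (c : A -> U) (B : finType) (b : B -> U)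
    (V : finType) (J : Type) (P : J -> (V -> U) -> Prop) :
  card_lt A K -> (forall t, definable (env c b) (P t)) ->
  (forall l (f : 'I_l -> J), exists v, forall t, P (f t) v) ->
  exists v, forall t, P t v.
Proof.
case: hU => sat_U K_big _ hA; apply: realize_definable.
by apply: sat_U; apply: (small_sum K_big).
Qed.

End Monster.

(** Two parameter families with the same first-order properties: every type
    that is realized over one of them, in a finite tuple of variables, is
    realized over the other as soon as the latter is saturated enough. *)
Lemma realize_type (L : language) (S S' : structure L) (A : Type)
    (c : A -> S) (c' : A -> S') (V : finType) (d : V -> S') :
  realizes_types_over c ->
  (forall phi : formula L A, sat c phi <-> sat c' phi) ->
  exists v, forall phi : formula L (V + A),
    sat (env v c) phi <-> sat (env d c') phi.
Proof.
move=> hreal hcc'.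
have [| l f|v Hv] := realize_definable
    (J := {phi | sat (env d c') phi})
    (P := fun phi v => sat (env v c) (sval phi)) hreal.
- by move=> phi; codef_tac.
- have [phi [H1 H2]] : codef c c'
      (fun _ : void -> S => exists v, forall t, sat (env v c) (sval (f t)))
      (fun _ : void -> S' => exists v, forall t, sat (env v c') (sval (f t))).
    by codef_tac.
  have E (X : structure L) (x : A -> X) : sat (env (of_void X) x) phi <->
      sat x (rename (fun z => match z with inl y => of_void A y | inr a => a end) phi).
    by rewrite sat_rename; apply: sat_eq; apply/funext; case.
  apply/(H1 (of_void S)); rewrite E hcc' -E -H2.
  by exists d => t; apply: proj2_sig (f t).
exists v => phi; have [p|p] := EM (sat (env d c') phi).
  by split=> // _; apply: (Hv (exist _ phi p)).
split=> // q; exfalso; exact: (Hv (exist _ (Neg phi) p)).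
Qed.

(** * Shattered tuples *)

(** The variables of an [r]-tuple of [V]-tuples, with the last entry in front. *)
Fixpoint power (V : finType) (r : nat) : finType :=
  if r is r'.+1 then ((V + power V r')%type : finType) else (void : finType).

Fixpoint pattern (S : Type) (V : finType) (X : set (V -> S)) (s : nat -> bool) r
    : (power V r -> S) -> Prop :=
  match r return (power V r -> S) -> Prop with
  | 0 => fun _ => True
  | r'.+1 => fun u =>
      (X (fun x => u (inl x)) <-> s r') /\ pattern X s (fun x => u (inr x))
  end.

Lemma pattern_eq (S : Type) (V : finType) (X : set (V -> S)) s s' r
    (u : power V r -> S) :
  (forall q, q < r -> s q = s' q) -> pattern X s u <-> pattern X s' u.
Proof.
elim: r u => //= r IH u ss'.
by rewrite ss' // IH // => q qr; apply: ss'; rewrite (ltn_trans qr).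
Qed.

Lemma pattern_comp (S S' : Type) (h : S -> S') (V : finType) (X : set (V -> S))
    (X' : set (V -> S')) s r (u : power V r -> S) :
  (forall x, X x <-> X' (h \o x)) -> pattern X s u <-> pattern X' s (h \o u).
Proof. by move=> XX'; elim: r u => //= r IH u; rewrite XX' IH. Qed.

Definition shattered (L : language) (S : structure L) (V W : finType)
    (phi : formula L (V + W)) r (u : power V r -> S) : Prop :=
  forall s, exists y, pattern (fun x => sat (env x y) phi) s u.

(** Only the first [r] bits of a pattern matter for an [r]-tuple, and this makes
    shattering a definable condition. *)
Definition finite_pattern r (t : {ffun 'I_r -> bool}) (q : nat) : bool :=
  if insub q is Some k then t k else false.

Lemma finite_patternP r (s : nat -> bool) q :
  q < r -> finite_pattern [ffun k : 'I_r => s k] q = s q.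
Proof. by move=> qr; rewrite /finite_pattern insubT /= ffunE. Qed.

Section CodefShattered.
Variables (L : language) (S1 S2 : structure L) (A : Type).
Variables (c1 : A -> S1) (c2 : A -> S2) (V W : finType) (phi : formula L (V + W)).

Lemma codef_pattern V' (y1 : (V' -> S1) -> W -> S1) y2 s r
    (u1 : (V' -> S1) -> power V r -> S1) u2 :
  cotuple c1 c2 y1 y2 -> cotuple c1 c2 u1 u2 ->
  codef c1 c2 (fun v => pattern (fun x => sat (env x (y1 v)) phi) s (u1 v))
              (fun v => pattern (fun x => sat (env x (y2 v)) phi) s (u2 v)).
Proof.
move=> hy; elim: r u1 u2 => [|r IH] u1 u2 hu /=; first by codef_tac.
apply: codef_and; first by codef_tac.
by apply: IH; apply: cotuple_comp.
Qed.

Lemma codef_shattered V' r (u1 : (V' -> S1) -> power V r -> S1) u2 :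
  cotuple c1 c2 u1 u2 ->
  codef c1 c2 (fun v => shattered phi (u1 v)) (fun v => shattered phi (u2 v)).
Proof.
move=> [f [f1 f2]].
have : codef c1 c2
  (fun v => forall t : {ffun 'I_r -> bool}, exists y,
     pattern (fun x => sat (env x y) phi) (finite_pattern t) (u1 v))
  (fun v => forall t : {ffun 'I_r -> bool}, exists y,
     pattern (fun x => sat (env x y) phi) (finite_pattern t) (u2 v)).
  apply: codef_forall_fin => t; apply: codef_ex; apply: codef_pattern; first by cotuple_tac.
  exists (fun x => match f x with inl v => inl (inl v) | inr a => inr a end).
  by split=> v; rewrite (f1, f2); apply/funext => x /=; case: (f x).
apply: codef_iff => v; split=> h.
- by move=> t; apply: h.
- move=> s; have [y hy] := h [ffun k : 'I_r => s k]; exists y.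
  by apply/(pattern_eq _ _ _).1: hy => q qr; rewrite finite_patternP.
- by move=> t; apply: h.
- move=> s; have [y hy] := h [ffun k : 'I_r => s k]; exists y.
  by apply/(pattern_eq _ _ _).1: hy => q qr; rewrite finite_patternP.
Qed.

End CodefShattered.

Section BoundedShattering.
Variables (L : language) (K : Type) (U : structure L).
Variables (V W : finType) (phi : formula L (V + W)).
Hypothesis hU : monster K U.

Fixpoint extends_by q r : (power V r -> U) -> Prop :=
  match q with
  | 0 => fun u => shattered phi u
  | q'.+1 => fun u =>
      exists x, extends_by q' (env x u : power V r.+1 -> U)
  end.

Lemma codef_extends_by A (c : A -> U) V' q r (u : (V' -> U) -> power V r -> U) :
  cotuple c c u u -> definable c (fun v => extends_by q (u v)).
Proof.
elim: q r V' u => [|q IH] r V' u hu /=; first exact: codef_shattered.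
apply: codef_ex; apply: IH; apply: cotuple_env; first by cotuple_tac.
case: hu => f [f1 _].
exists (fun x => match f x with inl v => inl (inl v) | inr a => inr a end).
by split=> v; rewrite f1; apply/funext => x /=; case: (f x).
Qed.

Lemma extends_by_le q q' r (u : power V r -> U) :
  q <= q' -> extends_by q' u -> extends_by q u.
Proof.
move=> /subnK <-; elim: (q' - q) => // {q'}d IH H; apply: IH.
move: H; rewrite addSn; elim: (d + q) r u => [|e IH] r u /= [x Hx]; last first.
  by exists x; apply: IH.
move=> s; have [y /= [_ Hy]] := Hx s; exists y.
by move: Hy; congr pattern; apply/funext.
Qed.

(** In the monster model, tuples of unbounded length shattered by [phi] give an
    infinite shattered sequence: by saturation a tuple which extends to
    arbitrarily long shattered ones can be prolonged with the same property. *)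
Lemma infinite_shattering :
  (forall r, exists u : power V r -> U, shattered phi u) ->
  exists (a : nat -> V -> U), forall s : set nat, exists y, forall q,
    sat (env (a q) y) phi <-> s q.
Proof.
move=> hsh; have [satU Kbig _] := hU.
pose good r (u : power V r -> U) := forall q, extends_by q u.
have good0 (u0 : power V 0 -> U) : good 0 u0.
  move=> q; have [u] := hsh q.
  have : forall p (u : power V q -> U), extends_by p u -> extends_by (p + q) u0.
    elim: q {u} => [|q IH] p u hu.
      by rewrite addn0 (_ : u0 = u) //; apply/funext; case.
    rewrite addnS -addSn; apply: (IH _ (fun x => u (inr x))) => /=.
    exists (fun x => u (inl x)); move: hu; congr extends_by.
    by apply/funext; case.
  by move=> H; apply: (H 0).
have goodS r (u : power V r -> U) : good r u -> exists x, good r.+1 (env x u).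
  move=> hu.
  apply: (monster_realize (A := void) (c := of_void U) (b := u) hU (J := nat)
    (P := fun q x => extends_by q (env x u : power V r.+1 -> U))).
  - apply: (countable_small Kbig); apply/card_leT_inj.
    by exists (of_void nat) => -[].
  - move=> q; apply: codef_extends_by; apply: cotuple_env; first by cotuple_tac.
    by exists (fun x => inr (inr x)).
  - move=> l f; have [x Hx] := hu (\max_t f t).+1.
    by exists x => t; apply: extends_by_le Hx; apply: leq_bigmax.
have [nxt Hnxt] := exists_choice (fun r => exists_choice (fun u : {u | good r u} =>
  goodS r (sval u) (proj2_sig u))).
pose u0 : power V 0 -> U := of_void U.
pose chain := fix chain r : {u | good r u} :=
  match r with 0 => exist (good 0) u0 (good0 u0)
  | r'.+1 => exist (good r'.+1) _ (Hnxt r' (chain r')) end.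
pose a r := nxt r (chain r).
have chain_pattern X s r : pattern X s (sval (chain r)) -> forall q, q < r ->
    (X (a q) <-> s q).
  elim: r => //= r IH [H1 H2] q; rewrite ltnS leq_eqVlt => /orP[/eqP->|qr].
    exact: H1.
  by apply: IH.
exists a => s.
apply: (monster_realize (A := nat * V) (c := fun p => a p.1 p.2)
  (b := of_void U) hU (J := nat) (P := fun q y => sat (env (a q) y) phi <-> s q)).
- apply: (countable_small Kbig); apply/card_leT_inj.
  by exists pickle; apply: pcan_inj pickleK.
- move=> q; apply: codef_equiv; last by codef_tac.
  apply: codef_sat; apply: cotuple_env; last by cotuple_tac.
  by exists (fun x => inr (inl (q, x))).
- move=> l f; have [y Hy] := proj2_sig (chain (\max_t f t).+1) 0 (fun q => `[< s q >]).
  exists y => t; have := chain_pattern _ _ _ Hy (f t).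
  rewrite ltnS leq_bigmax => /(_ isT) ->; split=> [/asboolP|] //.
  by move=> st; apply/asboolP.
Qed.

Lemma NIP_bounded_shattering (T : set (formula L void)) :
  NIP_theory T -> models T U ->
  exists r, forall u : power V r -> U, ~ shattered phi u.
Proof.
move=> hNIP hT; apply: contrapT => /forallNP hsh.
have [|a Ha] := infinite_shattering.
  by move=> r; have /existsNP[u /contrapT] := hsh r; exists u.
have [b Hb] := exists_choice Ha.
apply: (hNIP U hT #|V| #|W| (rename (fun z => match z with
  | inl v => inl (enum_rank v) | inr w => inr (enum_rank w) end) phi)).
exists (fun q => a q \o enum_val), (fun s => b s \o enum_val) => q s.
rewrite sat_rename -(Hb s q); apply: sat_eq.
by apply/funext; case=> z /=; rewrite enum_rankK.
Qed.

End BoundedShattering.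

(** * Honest definitions *)

Section Honest.
Variables (L : language) (M U : structure L) (j : M -> U).
Hypothesis hj : elementary j.
Variables (V W : finType) (phi : formula L (V + W)) (d : W -> U).

Let X : set (V -> M) := [set x | sat (env (j \o x) d) phi].

(** The small subsets [E] of [X]; that [X] itself is small means that it has an
    honest definition.  Captured finite sets stand in for points of an
    elementary extension of the pair formed by [M] and [X]. *)
Definition honest_on (E : set (V -> M)) : Prop :=
  exists (Z : finType) (theta : formula L (V + Z)),
    forall l (f : 'I_l -> V -> M), (forall t, E (f t)) ->
      exists c, (forall t, sat (env (f t) c) theta) /\
                (forall x, sat (env x c) theta -> X x).

Lemma honest_instance (E : set (V -> M)) (Z : finType)
    (theta : formula L (V + Z)) :
  (forall l (f : 'I_l -> V -> M), (forall t, E (f t)) ->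
    exists c, (forall t, sat (env (f t) c) theta) /\
              (forall x, sat (env x c) theta -> X x)) ->
  forall l (f : 'I_l -> V -> M),
    exists c, (forall t, E (f t) -> sat (env (f t) c) theta) /\
              (forall x, sat (env x c) theta -> X x).
Proof.
move=> H l f; pose p := [pred t | `[< E (f t) >]].
have [|c [c1 c2]] := H #|p| (fun t => f (enum_val t)).
  by move=> t; apply/asboolP; have := enum_valP t.
exists c; split=> // t Eft.
have pt : t \in p by apply/asboolP.
by rewrite -(enum_rankK_in pt pt); apply: c1.
Qed.

Lemma honest_sub E E' : E `<=` E' -> honest_on E' -> honest_on E.
Proof.
move=> EE' [Z [theta H]]; exists Z, theta => l f fE.
by apply: H => t; apply: EE'.
Qed.

Lemma honest_set0 : honest_on set0.
Proof.
exists void, Bot => l f fE; exists (of_void M).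
by split=> [t|x []]; have := fE t.
Qed.

Lemma honest_setU E1 E2 : honest_on E1 -> honest_on E2 -> honest_on (E1 `|` E2).
Proof.
move=> [Z1 [theta1 H1]] [Z2 [theta2 H2]].
have /codef_void[theta [Htheta _]] : definable (of_void M)
    (fun u : V + (Z1 + Z2) -> M =>
      sat (env (fun x => u (inl x)) (fun z => u (inr (inl z)))) theta1 \/
      sat (env (fun x => u (inl x)) (fun z => u (inr (inr z)))) theta2).
  by codef_tac.
exists (Z1 + Z2)%type, theta => l f fE.
have [c1 [h1 k1]] := honest_instance H1 f; have [c2 [h2 k2]] := honest_instance H2 f.
exists (env c1 c2); split=> [t|x]; rewrite -Htheta /=.
  by case: (fE t) => ?; [left; apply: h1|right; apply: h2].
by case=> ?; [apply: k1|apply: k2].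
Qed.

(** The [r]-fold product of [D], with the front entry as the outermost
    quantifier.  The definable sets in it form the type over [M] of a Morley
    sequence of the coheir given by [D], its latest entry in front. *)
Fixpoint iterated (D : set_system (V -> M)) r : set_system (power V r -> M) :=
  match r return set_system (power V r -> M) with
  | 0 => fun P => P (of_void M)
  | r'.+1 => fun P =>
      D [set x | iterated D [set u : power V r' -> M | P (env x u)]]
  end.

Lemma iterated_filter D r : ProperFilter D -> ProperFilter (iterated D (r := r)).
Proof.
move=> FD; elim: r => [|r IH] /=.
  by split=> //; split=> //= P Q PQ; apply: PQ.
apply: Build_ProperFilter_ex.
  move=> P /filter_ex[x] /filter_ex[u Hu].
  by exists (env x u).
split.
- by apply: filterS filterT => x _; apply: filterT.
- move=> P Q HP HQ; apply: filterS2 HP HQ => x HPx HQx.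
  exact: filterI HPx HQx.
- by move=> P Q PQ; apply: filterS => x; apply: filterS => u; apply: PQ.
Qed.

Lemma iterated_ultra D r (P : set (power V r -> M)) : UltraFilter D ->
  iterated D P \/ iterated D (~` P).
Proof.
move=> UD; elim: r P => [|r IH] P /=; first exact: EM.
have [|H] := in_ultra_setVsetC [set x | iterated D [set u | P (env x u)]] UD.
  by left.
by right; apply: filterS H => x /= Hx; case: (IH [set u | P (env x u)]).
Qed.

(** The front entry is chosen last.  The set [E] of its candidates is not small,
    so some finite part of [E] is contained in no fibre of [psi] that lies inside
    [X].  Choose the other entries by induction so that their fibre contains that
    finite part: it has points in [X], and it has points outside [X]. *)
Lemma large_meets_pattern D r (C : finType) (psi : formula L (power V r + C))
    (c : C -> M) s :
  UltraFilter D -> (forall E, D E -> ~ honest_on (E `&` X)) ->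
  iterated D [set u | sat (env u c) psi] ->
  exists u, sat (env u c) psi /\ pattern X s u.
Proof.
move=> UD large; elim: r C psi c => [|r IH] C psi c /=.
  by move=> H; exists (of_void M).
set E := [set x | _] => DE.
have /existsNP[l /existsNP[f /not_implyP[fE /forallNP noz]]] :
    ~ forall l (f : 'I_l -> V -> M), (forall t, (E `&` X) (f t)) ->
      exists z : power V r + C -> M,
        (forall t, sat (env (env (f t) (z \o inl)) (z \o inr)) psi) /\
        (forall x, sat (env (env x (z \o inl)) (z \o inr)) psi -> X x).
  move=> H; apply: (large E DE).
  pose assoc (z : power V r.+1 + C) : V + (power V r + C) := match z with
    | inl (inl x) => inl x | inl (inr u) => inr (inl u) | inr a => inr (inr a)
    end.
  exists (power V r + C)%type, (rename assoc psi) => l f fE.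
  have Hz (z : power V r + C -> M) x : sat (env x z) (rename assoc psi) <->
      sat (env (env x (z \o inl)) (z \o inr)) psi.
    by rewrite sat_rename; apply: sat_eq; apply/funext; case=> // -[].
  have [z [z1 z2]] := H l f fE; exists z.
  by split=> [t|x]; rewrite Hz; [apply: z1|apply: z2].
have [x0 [Ex0 Xx0]] : exists x, (E `&` X) x.
  apply: (filter_ex (F := D)); apply: filterI => //.
  have [//|DnX] := in_ultra_setVsetC X UD.
  by case: (large _ DnX); rewrite setICl; apply: honest_set0.
pose f' (o : option 'I_l) := oapp f x0 o.
pose c' := env (fun p : option 'I_l * V => f' p.1 p.2) c.
have [psi' [Hpsi' _]] : definable c' (fun u : power V r -> M =>
    forall o, sat (env (env (f' o) u) c) psi).
  apply: codef_forall_fin => o; apply: codef_sat.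
  apply: cotuple_env; last by exists (inr \o inr).
  by apply: cotuple_env; [exists (fun x => inr (inl (o, x)))|cotuple_tac].
have [|u [/Hpsi' Hu pu]] := IH _ psi' c'.
  have FD := iterated_filter r (ultra_proper (F := D)).
  suff : iterated D [set u | forall o, sat (env (env (f' o) u) c) psi].
    by apply: filterS => u /= /Hpsi'.
  apply: filter_forall => -[t|] //=.
  exact: (fE t).1.
case: (boolP (s r)) => sr.
  by exists (env x0 u); split; first exact: (Hu None).
have [x [px nXx]] : exists x, sat (env (env x u) c) psi /\ ~ X x.
  apply: contrapT => H; apply: (noz (env u c)); split=> [t|x Hx].
    exact: (Hu (Some t)).
  by apply: contrapT => nXx; apply: H; exists x.
exists (env x u); split=> //=; split=> //.
Qed.

(** With an ultrafilter avoiding the small sets, some pattern [s] is almost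
    surely realized by no instance of [phi] over [M], since otherwise a tuple
    would be shattered.  Yet [X], the trace of the instance at [d], realizes [s]
    on some tuple of that large set. *)
Lemma honest_definition r :
  (forall u : power V r -> U, ~ shattered phi u) -> honest_on X.
Proof.
move=> unshattered; apply: contrapT => nhX.
pose F0 : set_system (V -> M) := [set E | honest_on (X `\` E)].
have FF : ProperFilter F0.
  have F0E E : F0 E = honest_on (X `\` E) by [].
  split; first by rewrite F0E setD0.
  split.
  - by rewrite F0E setDT; apply: honest_set0.
  - by move=> P Q; rewrite !F0E setDIr; apply: honest_setU.
  - by move=> P Q PQ; apply: honest_sub; apply: setDS.
have [D [UD FD]] := ultraFilterLemma FF.
have large E : D E -> ~ honest_on (E `&` X).
  move=> DE hE; have /FD DnE : F0 (~` E) by rewrite /F0 /= setDE setCK setIC.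
  by apply: (filter_not_empty D); rewrite -(setICr E); apply: filterI.
have jM : of_void U = j \o of_void M by apply/funext; case.
have itF := iterated_filter r (ultra_proper (F := D)).
(* A tuple compatible with every realizable pattern is shattered. *)
have [s Hs] : exists s, iterated D [set u : power V r -> M |
    ~ exists y, pattern (fun x => sat (env x y) phi) s u].
  apply: contrapT => /forallNP H.
  have : iterated D [set u : power V r -> M | forall t : {ffun 'I_r -> bool},
      exists y, pattern (fun x => sat (env x y) phi) (finite_pattern t) u].
    apply: filter_forall => t.
    have [//|Ht] := iterated_ultra [set u : power V r -> M |
      exists y, pattern (fun x => sat (env x y) phi) (finite_pattern t) u] UD.
    by case: (H (finite_pattern t)).
  move=> /filter_ex[u Hu].
  have : shattered phi u.
    move=> s; have [y hy] := Hu [ffun k : 'I_r => s k]; exists y.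
    by apply/(pattern_eq _ _ _).1: hy => q qr; rewrite finite_patternP.
  have shC : codef (of_void M) (of_void U) (fun u : power V r -> M => shattered phi u)
      (fun u : power V r -> U => shattered phi u).
    by apply: codef_shattered; cotuple_tac.
  by rewrite jM in shC; move=> /(codef_transfer u hj shC).1; apply: unshattered.
have patC : codef (of_void M) (of_void U)
   (fun u : power V r -> M => ~ exists y, pattern (fun x => sat (env x y) phi) s u)
   (fun u : power V r -> U => ~ exists y, pattern (fun x => sat (env x y) phi) s u).
  by apply: codef_not; apply: codef_ex; apply: codef_pattern; cotuple_tac.
have [psi [Hpsi1 Hpsi2]] := patC.
have [|u [/Hpsi1 Hu pu]] := large_meets_pattern (psi := psi) (c := of_void M) s UD large.
  by apply: filterS Hs => u /= /Hpsi1.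
rewrite jM in patC; apply: ((codef_transfer u hj patC).1 Hu).
by exists d; apply/(pattern_comp (X := X) _ _ _).1: pu.
Qed.

End Honest.

(** * Quantifier elimination in the Shelah expansion *)

(** External definability with parameters from the monster model, for sets of
    tuples indexed by any type of variables. *)
Definition external (L : language) (M U : structure L) (j : M -> U) V
    (P : (V -> M) -> Prop) : Prop :=
  exists (W : finType) (phi : formula L (V + W)) (d : W -> U),
    forall a, P a <-> sat (env (j \o a) d) phi.

Section External.
Variables (L : language) (K : Type) (M U : structure L) (j : M -> U).
Hypotheses (hU : monster K U) (hj : elementary j) (hM : card_lt M K).
Hypothesis bounded : forall (V W : finType) (phi : formula L (V + W)),
  exists r, forall u : power V r -> U, ~ shattered phi u.

Lemma external_intro V W (phi : formula L (V + W)) (d : W -> U) :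
  external j (fun a => sat (env (j \o a) d) phi).
Proof.
have [W' [b [psi H]]] := fin_params phi.
by exists W', psi, (d \o b) => a; rewrite H.
Qed.

Lemma external_iff V (P Q : (V -> M) -> Prop) :
  (forall a, P a <-> Q a) -> external j Q -> external j P.
Proof.
by move=> PQ [W [phi [d H]]]; exists W, phi, d => a; rewrite PQ.
Qed.

Lemma external_imp V (P Q : (V -> M) -> Prop) :
  external j P -> external j Q -> external j (fun a => P a -> Q a).
Proof.
move=> [W [phi [d Hd]]] [Z [psi [e He]]].
have [xi [Hxi _]] : definable (env d e) (fun a : V -> U =>
    sat (env a d) phi -> sat (env a e) psi).
  apply: codef_imp; apply: codef_sat; apply: cotuple_env; try by cotuple_tac.
    by exists (fun z => inr (inl z)).
  by exists (fun z => inr (inr z)).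
by exists (W + Z)%type, xi, (env d e) => a; rewrite -Hxi Hd He.
Qed.

Lemma external_comp V V' (f : V' -> V) (P : (V' -> M) -> Prop) :
  external j P -> external j (fun a => P (fun x => a (f x))).
Proof.
move=> [W [phi [d Hd]]]; exists W, (rename (fun z => match z with
  | inl x => inl (f x) | inr w => inr w end) phi), d => a.
rewrite Hd sat_rename; apply: sat_eq; by apply/funext; case.
Qed.

(** Projecting an honest definition [theta] of a set projects the set itself on
    the points of [M]: for instances of [theta] over [M] which lie inside the
    set, there are no spurious witnesses. *)
Lemma external_proj (V Y : finType) (P : (V + Y -> M) -> Prop) :
  external j P -> external j (fun a : V -> M => exists y, P (env a y)).
Proof.
move=> [W [phi [d Hd]]].
have [r unsh] := bounded phi.
have [Z [theta /honest_instance Htheta]] := honest_definition hj d unsh.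
have /codef_void[xi [HM HU]] : codef (of_void M) (of_void U)
   (fun u : V + Z -> M => exists y : Y -> M,
      sat (env (env (fun x => u (inl x)) y) (fun z => u (inr z))) theta)
   (fun u : V + Z -> U => exists y : Y -> U,
      sat (env (env (fun x => u (inl x)) y) (fun z => u (inr z))) theta).
  by codef_tac.
pose Q (a : V -> M) := exists y, P (env a y).
have [||l f|c Hc] := monster_realize (A := M) (c := j) (b := of_void U) hU
    (J := V -> M) (P := fun a c => Q a <-> sat (env (j \o a) c) xi).
- exact: hM.
- move=> a; apply: codef_equiv; first by codef_tac.
  apply: codef_sat; apply: cotuple_env; last by cotuple_tac.
  by exists (fun x => inr (inl (a x))).
- have /exists_choice[y Hy] t : exists y, Q (f t) -> P (env (f t) y).
    have [[y Py]|nQ] := EM (Q (f t)); first by exists y.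
    by have [m0] := carrier_inhabited M; exists (fun=> m0).
  have [c [c1 c2]] := Htheta l (fun t => env (f t) (y t)).
  exists (j \o c) => t; rewrite -comp_env -(elementary_sat _ _ hj) -HM.
  split=> [/Hy Pft|[z /c2 Hz]]; last by exists z; apply/Hd.
  by exists (y t); apply: c1; apply/Hd.
by exists Z, xi, c => a; rewrite -Hc.
Qed.

Lemma external_all V (P : (option V -> M) -> Prop) :
  external j P -> external j (fun a : V -> M => forall b, P (oapp a b)).
Proof.
move=> [W [phi [d Hd]]].
pose f (z : option V + W) : (unit + W) + V := match z with
  | inl (Some v) => inr v | inl None => inl (inl tt) | inr w => inl (inr w) end.
have [W' [b [psi Hpsi]]] := formula_fin_params f phi.
pose P' (u : W' + unit -> M) :=
  sat (env (env (fun z : unit => j (u (inr z))) d) (fun z => j (u (inl z)))) psi -> False.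
have : external j P'.
  apply: external_imp; last by exists void, Bot, (of_void U).
  apply: external_iff (external_intro (rename (fun z => match z with
    | inl (inl z) => inl (inr z) | inl (inr w) => inr w | inr w' => inl (inl w')
    end) psi) d) => a.
  by rewrite sat_rename; apply: sat_eq; apply/funext; case=> // -[].
move=> /external_proj /(external_comp b) H.
apply: external_iff (external_imp H (Q := fun=> False) _); last first.
  by exists void, Bot, (of_void U).
have E (a : V -> M) m : P (oapp a m) <->
    sat (env (env (fun _ : unit => j m) d) (fun z => j (a (b z)))) psi.
  rewrite Hd -[X in _ <-> X](Hpsi U _ (j \o a)); apply: sat_eq.
  by apply/funext; case=> //= -[].
move=> a; split=> [h [y]|h m].
  have -> : y = fun=> y tt by apply/funext => -[].
  by move=> nP; apply: nP; apply/E/h.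
apply/E; apply: contrapT => nE; apply: h.
by exists (fun=> m).
Qed.

Lemma external_app V n (t : 'I_n -> term L V) (P : ('I_n -> M) -> Prop) :
  external j P -> external j (fun a => P (fun i => eval a (t i))).
Proof.
move=> [W [phi [d Hd]]].
have /codef_void[psi [Hpsi _]] : definable (of_void U) (fun u : V + W -> U =>
    exists z : 'I_n -> U, (forall i, z i = eval (fun x => u (inl x)) (t i)) /\
      sat (env z (fun w => u (inr w))) phi).
  apply: codef_ex; apply: codef_and; last by codef_tac.
  apply: codef_forall_fin => i.
  exists (Eq (Var L (inl (inr i)))
    (term_rename (fun x => inl (inl (inl x))) (t i))).
  by split=> v /=; rewrite eval_rename.
have evj (a : V -> M) u : eval (j \o a) u = j (eval a u).
  have := elementary_sat (Eq (Var L None) (term_rename Some u)) (oapp a (eval a u)) hj.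
  by rewrite /= !eval_rename => -[H _]; rewrite -[RHS]/(j _) (H erefl).
exists W, psi, d => a; rewrite -Hpsi Hd; split=> [H|[z [Hz H]]].
  exists (j \o (fun i => eval a (t i))); split=> //= i.
  by rewrite -evj.
by rewrite (_ : j \o _ = z) //; apply/funext => i /=; rewrite Hz -evj.
Qed.

Variables (N : structure L) (k : M -> N).
Hypothesis hk : elementary k.

Lemma externally_definable_external n (X : set ('I_n -> M)) :
  externally_definable k X -> external j X.
Proof.
move=> [m [phi [d ->]]].
have [||v Hv] := realize_type (c := j) (c' := k) d.
- case: hU => satU _ _; apply: satU; exact: hM.
- move=> psi; rewrite -[j]/(j \o id) -[k]/(k \o id).
  by rewrite -!elementary_sat.
exists 'I_m, phi, v => a /=.
have := Hv (rename (fun z => match z with inl i => inr (a i) | inr w => inl w end) phi).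
rewrite !sat_rename.
rewrite (_ : _ \o _ = env (j \o a) v); last by apply/funext; case.
by move=> ->; apply: sat_eq; apply/funext; case.
Qed.

Fixpoint term_reduct V (t : term (shelah_language k) V) : term L V :=
  match t with
  | Var v => Var L v
  | App f args => @App L V f (fun i => term_reduct (args i))
  end.

Lemma eval_reduct V (t : term (shelah_language k) V) (a : V -> shelah k) :
  eval a t = eval (a : V -> M) (term_reduct t).
Proof. by elim: t => //= f args IH; congr fun_int; apply/funext. Qed.

Lemma shelah_external V (phi : formula (shelah_language k) V) :
  external j (fun a : V -> M => sat (a : V -> shelah k) phi).
Proof.
elim: phi => {V} [V|V t u|V r args|V p IHp q IHq|V p IH].
- by exists void, Bot, (of_void U).
- apply: external_iff (external_intro (rename inl (Eq (term_reduct t) (term_reduct u)))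
     (of_void U)) => a.
  rewrite sat_rename -(elementary_sat (Eq _ _) a hj) /= -!eval_reduct.
  by [].
- case: r args => [r|[n [X HX]]] args.
    apply: external_iff (external_intro (rename inl (@Atom L V r (fun i => term_reduct (args i))))
      (of_void U)) => a.
    rewrite sat_rename -(elementary_sat (@Atom L V r _) a hj) /=.
    rewrite (_ : (fun i => @eval _ (shelah k) V a (args i)) = (fun i => eval (a : V -> M) (term_reduct (args i)))) //.
    by apply/funext => i; apply: eval_reduct.
  apply: external_iff (external_app (fun i => term_reduct (args i))
    (externally_definable_external HX)) => a /=.
  rewrite (_ : (fun i => @eval _ (shelah k) V a (args i)) = (fun i => eval (a : V -> M) (term_reduct (args i)))) //.
  by apply/funext => i; apply: eval_reduct.
- exact: external_imp.
- exact: (external_all IH).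
Qed.

End External.

(** * Test points in fsg groups *)

Lemma sat_push (L : language) (S : structure L) X A B (e : A -> B)
    (phi : formula L (X + A)) (x : X -> S) (c : B -> S) :
  sat (env x c) (push_params e phi) <-> sat (env x (c \o e)) phi.
Proof. by rewrite sat_rename; apply: sat_eq; apply/funext; case. Qed.

Section Fsg.
Variables (L : language) (K : Type) (U : structure L) (n : nat).
Variables (G : set ('I_n -> U)) (R : ('I_n -> U) -> ('I_n -> U) -> ('I_n -> U) -> Prop).
Variables (p : set (formula L ('I_n + U))) (M1 : structure L) (e : M1 -> U).
Variables (pi : set (formula L ('I_n + M1))) (mu : formula L ('I_n + 'I_n + 'I_n + M1)).
Hypotheses (hU : monster K U) (hM1 : card_lt M1 K).
Hypothesis hG : type_definable_group e pi mu G R.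
Hypotheses (hp : complete_type p) (ppi : forall phi, pi phi -> p (push_params e phi)).
Hypothesis hfs : forall g, G g -> finitely_satisfiable_in id
  (G `&` [set a | exists a1 : 'I_n -> M1, a = e \o a1]) (translate e mu g p).

(** The formulas of [p] together with the type defining [G] are realized in the
    monster model, so that what they imply on [G] belongs to [p]. *)
Lemma type_entails (I : finType) (phi : I -> formula L ('I_n + U))
    (psi : formula L ('I_n + U)) :
  (forall t, p (phi t)) ->
  (forall a, G a -> (forall t, defset id (phi t) a) -> defset id psi a) ->
  p psi.
Proof.
move=> pphi H; have [fsp total] := hp; have [//|pN] := total psi.
pose fam (o : option I) := if o is Some t then phi t else Neg psi.
have [W [b [fam' Hfam]]] := fin_params_family fam.
pose J := (option I + {phi | pi phi})%type.
pose P (t : J) (a : 'I_n -> U) := match t with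
  | inl o => sat (env a id) (fam o)
  | inr q => sat (env a e) (sval q) end.
have [|[o|q]|l f|a Ha] := monster_realize (c := e) (b := b) hU (P := P).
- exact: hM1.
- have : definable (env e b) (fun a : 'I_n -> U => sat (env a (id \o b)) (fam' o)).
    apply: codef_sat; apply: cotuple_env; first by cotuple_tac.
    by exists (inr \o inr).
  by apply: codef_iff => a; rewrite /= Hfam.
- apply: codef_sat; apply: cotuple_env; first by cotuple_tac.
  by exists (inr \o inl).
- pose form (t : J) := match t with
    inl o => fam o | inr q => push_params e (sval q) end.
  have pform t : p (form t).
    case: t => [[t|]|q] //=.
    exact: ppi (proj2_sig q).
  have [||a _ Ha] := fsp (range (form \o f)).
  + by apply/finite_set_family; exists l, (form \o f).
  + by move=> _ [t _ <-]; apply: pform.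
  exists a => t; have := Ha _ (ex_intro2 _ _ t Logic.I erefl); rewrite /= /defset /=.
  by case: (f t) => //= q /sat_push.
exfalso; have Ga : G a.
  by case: hG => -> _ _ q piq; apply: (Ha (inr (exist _ q piq))).
apply: (Ha (inl None)); apply: H => // t.
exact: (Ha (inl (Some t))).
Qed.

(** Finite satisfiability of the translate [g p], with membership in [g p]
    expressed through pointwise multiplication by [g] on [G]. *)
Lemma translate_meets (I : finType) (phi : I -> formula L ('I_n + U)) g
    (chi : formula L ('I_n + U)) :
  G g -> (forall t, p (phi t)) ->
  (forall a, G a -> (forall t, defset id (phi t) a) ->
     exists2 d, R g a d & defset id chi d) ->
  exists a : 'I_n -> M1, G (e \o a) /\ defset id chi (e \o a).
Proof.
move=> Gg pphi H.
have [psi [Hpsi _]] : definable (id : U -> U) (fun a : 'I_n -> U =>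
    exists2 d, graph e mu g a d & defset id chi d).
  apply: codef_ex2; apply: codef_sat; last by cotuple_tac.
  apply: cotuple_env; last by exists (fun x => inr (e x)).
  apply: cotuple_env; last by cotuple_tac.
  by apply: cotuple_env; [exists (fun x => inr (g x)) | cotuple_tac].
have [|psi' |b [Gb [a ba]] Hb] := hfs Gg (F := [set chi]).
- exact: finite_set1.
- move=> ->; exists psi.
    apply: (type_entails pphi) => a Ga Ha; apply/Hpsi.
    have [d Rd Cd] := H a Ga Ha; exists d => //.
    by case: hG => _ [_ hR] _; apply/hR.
  by apply/seteqP; split=> a /Hpsi.
by exists a; rewrite -ba; split=> //; apply: Hb.
Qed.

(** If the instances at [y] of the formulas [phi t] cover [G(M1)], some of them,
    say [X], is in the generic type [p]; as the translates of [p] are finitely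
    satisfiable, no translate of [X] misses [G(M1)].  Compactness turns this into
    a statement about a finite part of [G(M1)] which works for all [y]. *)
Lemma test_points_in_base (I Y : finType) (phi : I -> formula L ('I_n + Y)) :
  exists l (a : 'I_l -> 'I_n -> M1), (forall t, G (e \o a t)) /\
    forall y : Y -> U, (forall t, exists s, sat (env (e \o a t) y) (phi s)) ->
      exists s, forall g, G g -> exists t h,
        R g (e \o a t) h /\ sat (env h y) (phi s).
Proof.
have [_ [hmu hR] [hmul hassoc [one Gone hone]]] := hG.
apply: contrapT => H.
have bad l (a : 'I_l -> 'I_n -> M1) : (forall t, G (e \o a t)) ->
    exists y : Y -> U, (forall t, exists s, sat (env (e \o a t) y) (phi s)) /\
      exists g : I -> 'I_n -> U, forall s, G (g s) /\
        forall t h, R (g s) (e \o a t) h -> ~ sat (env h y) (phi s).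
  move=> Ga; apply: contrapT => nbad; apply: H; exists l, a; split=> // y Hy.
  apply: contrapT => nex; apply: nbad; exists y; split=> //.
  apply: (exists_choice (P := fun s gs => G gs /\
    forall t h, R gs (e \o a t) h -> ~ sat (env h y) (phi s))) => s.
  apply: contrapT => ng; apply: nex.
  exists s => g Gg; apply: contrapT => nth; apply: ng; exists g; split=> // t h Rh sh.
  by apply: nth; exists t, h.
have [a0 [Ga0 _]] : exists a, G (e \o a) /\ defset id (Imp Bot Bot) (e \o a).
  apply: (translate_meets (I := void) (phi := of_void _) Gone) => [[]|a Ga _].
  by exists a => //; have [] := hone a Ga.
pose J := ({q | pi q} + {a | G (e \o a)})%type.
pose P (t : J) (v : Y + I * 'I_n -> U) := match t with
  | inl q => forall s, sat (env (fun x => v (inr (s, x))) e) (sval q)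
  | inr a => (exists s, sat (env (e \o sval a) (fun z => v (inl z))) (phi s)) /\
      forall s (h : 'I_n -> U), graph e mu (fun x => v (inr (s, x))) (e \o sval a) h ->
        ~ sat (env h (fun z => v (inl z))) (phi s) end.
have [|[q|a]|l f|v Hv] := monster_realize (c := e) (b := of_void U) hU (P := P).
- exact: hM1.
- apply: codef_forall_fin => s; apply: codef_sat; apply: cotuple_env.
    by cotuple_tac.
  by exists (inr \o inl).
- have ha : forall V, cotuple (env e (of_void U)) (env e (of_void U))
      (fun _ : V -> U => e \o sval a) (fun _ : V -> U => e \o sval a).
    by move=> V; exists (fun x => inr (inl (sval a x))).
  have he : forall V, cotuple (env e (of_void U)) (env e (of_void U))
      (fun _ : V -> U => e) (fun _ : V -> U => e).
    by move=> V; exists (inr \o inl).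
  apply: codef_and.
    apply: codef_exists_fin => s; apply: codef_sat; apply: cotuple_env => //.
    by cotuple_tac.
  apply: codef_forall_fin => s; apply: codef_all; apply: codef_imp; last by codef_tac.
  apply: codef_sat; apply: cotuple_env => //; apply: cotuple_env; last by cotuple_tac.
  by apply: cotuple_env => //; cotuple_tac.
- pose a t := match f t with inl _ => a0 | inr b => sval b end.
  have Ga t : G (e \o a t) by rewrite /a; case: (f t) => // b; apply: proj2_sig b.
  have [y [Hy [g Hg]]] := bad l a Ga.
  exists (env y (fun z => g z.1 z.2)) => t.
  case E: (f t) => [q|b] /=.
    move=> s; have [Gg _] := Hg s; case: hG Gg => -> _ _; apply.
    exact: proj2_sig q.
  have at_b : a t = sval b by rewrite /a E.
  rewrite -at_b; split=> [|s h Rh]; first exact: Hy.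
  have [Gg Rg] := Hg s; apply: (Rg t); exact/hR.
pose y z := v (inl z); pose g s x := v (inr (s, x)).
have Gg s : G (g s).
  by case: hG => -> _ _ q piq; apply: (Hv (inl (exist _ q piq)) s).
pose Phi s := push_params y (phi s).
have [s pPhi] : exists s, p (Phi s).
  apply: contrapT => /forallNP nP.
  have pN s : p (Neg (Phi s)) by case: (hp.2 (Phi s)) => // /nP.
  have [chi [Hchi _]] : definable (id : U -> U) (fun a : 'I_n -> U =>
      forall s, ~ sat (env a y) (phi s)).
    apply: codef_forall_fin => s; apply: codef_not; apply: codef_sat.
    by apply: cotuple_env; [cotuple_tac | exists (inr \o y)].
  have [|a [Ga /Hchi Ha]] := translate_meets (chi := chi) Gone pN.
    move=> a Ga Ha; exists a; first by have [] := hone a Ga.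
    by apply/Hchi => s sa; apply: (Ha s); apply/sat_push.
  by have [[s /Ha]] := Hv (inr (exist (fun a => G (e \o a)) a Ga)).
have [_ _ [h Gh [gh hg]]] := hone _ (Gg s).
have [chi [Hchi _]] : definable (id : U -> U) (fun a : 'I_n -> U =>
    exists z : 'I_n -> U, graph e mu (g s) a z /\ sat (env z y) (phi s)).
  apply: codef_ex; apply: codef_and; apply: codef_sat.
    apply: cotuple_env; last by exists (fun x => inr (e x)).
    apply: cotuple_env; last by cotuple_tac.
    by apply: cotuple_env; [exists (fun x => inr (g s x)) | cotuple_tac].
  by apply: cotuple_env; [cotuple_tac | exists (inr \o y)].
have [|a [Ga /Hchi[z [gz sz]]]] :=
    translate_meets (I := unit) (phi := fun=> Phi s) (chi := chi) Gh (fun=> pPhi).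
  move=> a Ga /(_ tt) /sat_push Ha; have [d Gd hd] := hmul _ _ Gh Ga.
  have Rd : R h a d by apply/hd.
  exists d => //; apply/Hchi; exists a; split=> //.
  apply/hR => //; apply: (hassoc _ _ _ one d a (Gg s) Gh Ga gh Rd).
  by have [] := hone a Ga.
by have [_ /(_ s z gz)] := Hv (inr (exist (fun a => G (e \o a)) a Ga)).
Qed.

End Fsg.

Section TypeDefinableGroup.
Variables (L : language) (K : Type) (M0 M U : structure L) (i : M0 -> M) (j : M -> U).
Hypotheses (hU : monster K U) (hi : elementary i) (hj : elementary j).
Hypotheses (hMsat : succ_saturated M0 M) (hM : card_lt M K).
Variables (n : nat) (pi : set (formula L ('I_n + M0))).
Variable (mu : formula L ('I_n + 'I_n + 'I_n + M0)).
Let G := typeset (j \o i) pi.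
Let R := graph (j \o i) mu.

Lemma typeset_elementary (a : 'I_n -> M) : typeset i pi a <-> G (j \o a).
Proof.
by split=> H q /H; rewrite /defset /= (elementary_sat _ _ hj) comp_env.
Qed.

(** Saturation of [M] realizes the type of [d] over [M0] in [M], and homogeneity
    of the monster model turns equality of types into an automorphism. *)
Lemma automorphism_into (V : finType) (d : V -> U) :
  exists (s : U -> U) (v : V -> M),
    [/\ automorphism s, s \o (j \o i) = j \o i & s \o d = j \o v].
Proof.
have [_ Kbig hom] := hU.
have [||v Hv] := realize_type (c := i) (c' := j \o i) d.
- exact: hMsat.
- by move=> phi; rewrite (elementary_sat _ _ hj).
have [||s autos Hs] := hom (M0 + V)%type (env (j \o i) d) (env (j \o i) (j \o v)).
- by apply: (small_sum Kbig); apply: (elementary_card hi).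
- move=> phi; have := Hv (rename (fun z => match z with
    inl a => inr a | inr x => inl x end) phi).
  rewrite !sat_rename.
  have -> : env d (j \o i) \o (fun z : M0 + V => match z with
    inl a => inr a | inr x => inl x end) = env (j \o i) d by apply/funext; case.
  have -> : env v i \o (fun z : M0 + V => match z with
    inl a => inr a | inr x => inl x end) = env i v by apply/funext; case.
  by rewrite (elementary_sat _ _ hj) comp_env => H; rewrite -H.
exists s, v; split=> //; apply/funext => x; [exact: (Hs (inl x))|exact: (Hs (inr x))].
Qed.

(** The conclusion of [test_points_in_base] is invariant under automorphisms
    that preserve [G], so the points may be moved into [M].  The member of the
    cover that it provides is generic: since all its translates meet the points
    [a t], its right translates by their inverses cover [G]. *)
Lemma uniform_test_points (I Y : finType) (phi : I -> formula L ('I_n + Y)) :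
  fsg K G R ->
  exists l (a : 'I_l -> 'I_n -> M), (forall t, G (j \o a t)) /\
    forall y : Y -> U, (forall t, exists s, sat (env (j \o a t) y) (phi s)) ->
      exists s, forall g, G g -> exists t h,
        R g (j \o a t) h /\ sat (env h y) (phi s).
Proof.
move=> [p [M1 [e [pi1 [mu1 [[hM1 _] hG1 hp ppi hfs]]]]]].
have [l [a [Ga Ha]]] := test_points_in_base hU hM1 hG1 hp ppi hfs phi.
have [s [v [autos si sv]]] := automorphism_into (fun z : 'I_l * 'I_n => e (a z.1 z.2)).
have [[s' sK s'K] _ _] := autos.
have sva t : j \o (fun x => v (t, x)) = s \o (e \o a t).
  by apply/funext => x; rewrite -[LHS]/((j \o v) (t, x)) -sv.
have sG g : G g <-> G (s \o g).
  split=> H q piq.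
    by move: (H q piq); rewrite /defset /= (sat_automorphism _ _ autos) comp_env si.
  by rewrite /defset /= (sat_automorphism _ _ autos) comp_env si; apply: H.
have sR g b h : R g b h <-> R (s \o g) (s \o b) (s \o h).
  by rewrite /R /graph (sat_automorphism _ _ autos) !comp_env si.
have s'E X (x : X -> U) : s \o (s' \o x) = x by apply/funext => z /=; rewrite s'K.
exists l, (fun t x => v (t, x)); split=> [t|y Hy].
  by rewrite sva -sG; apply: Ga.
have [|r Hr] := Ha (s' \o y).
  move=> t; have [r Hr] := Hy t; exists r.
  by rewrite (sat_automorphism _ _ autos) comp_env s'E -sva.
exists r => g Gg.
have [|t [h [Rh sh]]] := Hr (s' \o g); first by rewrite sG s'E.
exists t, (s \o h); split.
  by rewrite sva -[X in R X](s'E _ g) -sR.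
by move: sh; rewrite (sat_automorphism _ _ autos) comp_env s'E.
Qed.

(** Some instance of [theta] contains the test points and is contained in [G].
    The union [D] of its right translates by the inverses of these points is then
    equal to [G], and by compactness finitely many formulas of [pi] imply [D]. *)
Lemma fsg_definable (Z : finType) (theta : formula L ('I_n + Z)) :
  group_on G R -> fsg K G R ->
  (forall l (f : 'I_l -> 'I_n -> M), (forall t, typeset i pi (f t)) ->
    exists c, (forall t, sat (env (f t) c) theta) /\
              (forall x, sat (env x c) theta -> typeset i pi x)) ->
  exists psi : formula L ('I_n + M0), G = defset (j \o i) psi.
Proof.
move=> [hmul hassoc [one Gone hone]] hfsg honest.
have [l [a [Ga Ha]]] := uniform_test_points (I := unit) (fun=> theta) hfsg.
have [|c [ca cG]] := honest l a; first by move=> t; apply/typeset_elementary.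
have cGU h : sat (env h (j \o c)) theta -> G h.
  move=> Hh q piq.
  have cd : codef (env i c) (env (j \o i) (j \o c))
     (fun _ : void -> M => forall x, sat (env x c) theta -> sat (env x i) q)
     (fun _ : void -> U => forall x, sat (env x (j \o c)) theta ->
        sat (env x (j \o i)) q).
    apply: codef_all; apply: codef_imp; apply: codef_sat; apply: cotuple_env.
    - by cotuple_tac.
    - by exists (inr \o inr).
    - by cotuple_tac.
    - by exists (inr \o inl).
  rewrite -comp_env in cd.
  by apply: ((codef_transfer (of_void M) hj cd).1 _ h Hh) => x /cG; apply.
have [_ gen] := Ha (j \o c) (fun t => ex_intro _ tt
  (iffLR (sat_eq _ (comp_env j (a t) c)) (iffLR (elementary_sat _ _ hj) (ca t)))).
have /exists_choice[b Hb] t : exists b, [/\ G b, R (j \o a t) b one & R b (j \o a t) one].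
  by have [_ _ [b Gb [ab ba]]] := hone _ (Ga t); exists b.
pose D (g : 'I_n -> U) := exists t h, sat (env h (j \o c)) theta /\ R h (b t) g.
have GD g : G g <-> D g.
  split=> [Gg|[t [h [/cGU Gh Rg]]]]; last first.
    by have [Gb _ _] := Hb t; have [d Gd Hd] := hmul _ _ Gh Gb; rewrite ((Hd g).1 Rg).
  have [t [h [Rh sh]]] := gen g Gg; exists t, h; split=> //.
  have [Gb ab _] := Hb t; have [d _ Hd] := hmul _ _ (cGU h sh) Gb.
  have [_ g1 _] := hone g Gg; have [g' _ Hg'] := hmul _ _ Gg Gone.
  have Rd : R h (b t) d by apply/Hd.
  have /Hg' dg' := hassoc _ _ _ h one d Gg (Ga t) Gb Rh ab Rd.
  by rewrite ((Hg' g).1 g1) -dg'.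
have [l' [f [fpi fG]]] : exists l (f : 'I_l -> formula L ('I_n + M0)),
    (forall t, pi (f t)) /\
    forall g, (forall t, defset (j \o i) (f t) g) -> G g.
  apply: contrapT => nfin.
  have [||l' f|g Hg] := monster_realize (A := M0) (c := j \o i)
    (b := env (j \o c) (fun z => b z.1 z.2)) hU (J := {q | pi q})
    (P := fun q g => defset (j \o i) (sval q) g /\ ~ D g).
  - by apply: (elementary_card hi).
  - move=> q; apply: codef_and.
      by apply: codef_sat; apply: cotuple_env; [cotuple_tac | exists (inr \o inl)].
    apply: codef_not; apply: codef_exists_fin => t; apply: codef_ex.
    apply: codef_and; apply: codef_sat.
      by apply: cotuple_env; [cotuple_tac | exists (fun z => inr (inr (inl z)))].
    apply: cotuple_env; last by exists (inr \o inl).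
    apply: cotuple_env; last by cotuple_tac.
    apply: cotuple_env; first by cotuple_tac.
    by exists (fun x => inr (inr (inr (t, x)))).
  - apply: contrapT => /forallNP nsat; apply: nfin.
    exists l', (fun t => sval (f t)); split=> [t|g Hg]; first exact: proj2_sig (f t).
    apply/GD; apply: contrapT => nD; apply: (nsat g) => t; split=> //.
  - have GG : G g by move=> q piq; apply: (Hg (exist _ q piq)).1.
    have [[q piq]|nopi] := EM (exists q, pi q).
      by apply: (Hg (exist _ q piq)).2; apply/GD.
    apply: nfin; exists 0, (fun=> Bot); split=> [[]//|x _ q piq].
    by case: nopi; exists q.
have [psi [Hpsi _]] : definable (j \o i) (fun g : 'I_n -> U =>
    forall t, defset (j \o i) (f t) g).
  by apply: codef_forall_fin => t; codef_tac.
exists psi; apply/seteqP; split=> g.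
  by move=> Gg; apply/Hpsi => t; apply: Gg.
by move=> /Hpsi; apply: fG.
Qed.

End TypeDefinableGroup.

(** * Definable fsg groups *)

(** Taking the graph of [mu] itself as multiplication turns the definition of a
    definable group into first-order axioms on [psi] and [mu]. *)
Definition group_axioms (L : language) (S : structure L) (A : Type) n (c : A -> S)
    (psi : formula L ('I_n + A)) (mu : formula L ('I_n + 'I_n + 'I_n + A)) : Prop :=
  (forall a b d d', graph c mu a b d -> graph c mu a b d' -> d = d') /\
  group_on (defset c psi) (graph c mu).

Lemma definable_groupP (L : language) (S : structure L) (A : Type) n (c : A -> S)
    (psi : formula L ('I_n + A)) (mu : formula L ('I_n + 'I_n + 'I_n + A)) :
  group_axioms c psi mu ->
  definable_group c psi mu (defset c psi) (graph c mu).
Proof. by move=> [? ?]; split. Qed.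

Lemma group_axioms_elementary (L : language) (S1 S2 : structure L) (e : S1 -> S2) n
    (psi : formula L ('I_n + S1)) (mu : formula L ('I_n + 'I_n + 'I_n + S1)) :
  elementary e -> group_axioms id psi mu <-> group_axioms e psi mu.
Proof.
move=> he.
have cd : codef (id : S1 -> S1) (e \o id) (fun _ : void -> S1 => group_axioms id psi mu)
   (fun _ : void -> S2 => group_axioms e psi mu).
  rewrite -[e \o id]/e; apply: codef_and; first by codef_tac.
  pose ax (S : structure L) (c : S1 -> S) :=
    (forall a b, defset c psi a -> defset c psi b ->
        exists2 d, defset c psi d & forall d', graph c mu a b d' <-> d' = d) /\
    (forall a b d u v w, defset c psi a -> defset c psi b -> defset c psi d ->
        graph c mu a b u -> graph c mu b d v -> graph c mu u d w ->
        graph c mu a v w) /\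
    exists2 one, defset c psi one & forall a, defset c psi a ->
      graph c mu one a a /\ graph c mu a one a /\
      exists2 b, defset c psi b & graph c mu a b one /\ graph c mu b a one.
  have axE (S : structure L) (c : S1 -> S) :
      group_on (defset c psi) (graph c mu) <-> ax S c.
    split=> [[h1 h2 [one G1 h3]]|[h1 [h2 [one G1 h3]]]].
      by do 2 split=> //; exists one => // a /h3 [].
    by split=> //; exists one => // a /h3 [? []].
  apply: (codef_iff (Q1 := fun=> ax S1 id) (Q2 := fun=> ax S2 e)) => //.
  rewrite /ax; codef_tac.
exact: codef_transfer (of_void S1) he cd.
Qed.

Section FsgFromPartition.
Variables (L : language) (K : Type) (S U : structure L) (e : S -> U) (n : nat).
Variables (psi : formula L ('I_n + S)) (mu : formula L ('I_n + 'I_n + 'I_n + S)).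
Let G := defset e psi.
Let R := graph e mu.
Hypotheses (he : elementary e) (hS : card_lt S K) (hgrp : group_axioms e psi mu).

(** [X] meets every translate of [G(S)] because finitely many points of [G(S)]
    already suffice; equivalently finitely many right translates of [X] by
    points of [G(S)] cover [G]. *)
Definition generic (X : set ('I_n -> U)) : Prop :=
  exists l (a : 'I_l -> 'I_n -> S), (forall t, G (e \o a t)) /\
    forall g, G g -> exists t h, R g (e \o a t) h /\ X h.

Hypothesis cover_generic : forall (I Y : finType) (phi : I -> formula L ('I_n + Y))
    (y : Y -> U), (forall x, G x -> exists s, sat (env x y) (phi s)) ->
  exists s, generic [set x | sat (env x y) (phi s)].

Lemma cover_generic_params (I : finType) (phi : I -> formula L ('I_n + U)) :
  (forall x, G x -> exists s, defset id (phi s) x) ->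
  exists s, generic (defset id (phi s)).
Proof.
move=> cov; have [Y [y [phi' H]]] := fin_params_family phi.
have [|s Hs] := cover_generic (phi := phi') (y := y).
  by move=> x /cov[s Hs]; exists s; apply/(H s U x id).
exists s; suff -> : defset id (phi s) = [set x | sat (env x y) (phi' s)] by [].
by apply/seteqP; split=> x /(H s U x id).
Qed.

(** By the hypothesis the complements of the definable sets which are not
    generic have the finite intersection property in [G]; any complete type
    containing them witnesses fsg. *)
Lemma generic_ultrafilter : exists D : set_system ('I_n -> U),
  [/\ UltraFilter D, D G &
      forall phi, D (defset id phi) -> generic (defset id phi)].
Proof.
pose F0 : set_system ('I_n -> U) := [set E |
  exists (I : finType) (phi : I -> formula L ('I_n + U)),
    (forall s, ~ generic (defset id (phi s))) /\
    forall x, G x -> (forall s, ~ defset id (phi s) x) -> E x].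
have FF : ProperFilter F0.
  split.
    move=> [I [phi [ngen Hphi]]].
    have [|s] := cover_generic_params (phi := phi); last exact: ngen.
    by move=> x /Hphi H; apply: contrapT => /forallNP.
  split.
  - by exists void, (of_void _); split=> // -[].
  - move=> P Q [I [phi [gP HP]]] [J [chi [gQ HQ]]].
    exists (I + J)%type, (fun z => match z with inl s => phi s | inr s => chi s end).
    split=> [[]//|x Gx H].
    by split; [apply: HP => // s; apply: (H (inl s))|apply: HQ => // s; apply: (H (inr s))].
  - move=> P Q PQ [I [phi [gP HP]]]; exists I, phi; split=> // x Gx H.
    by apply: PQ; apply: HP.
have [D [UD FD]] := ultraFilterLemma FF; exists D; split=> //.
  by apply: FD; exists void, (of_void _); split=> // -[].
move=> phi Dphi; apply: contrapT => ngen.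
have Dn : D (~` defset id phi).
  by apply: FD; exists unit, (fun=> phi); split=> // x _ /(_ tt).
by apply: (filter_not_empty D); rewrite -(setICr (defset id phi)); apply: filterI.
Qed.

Lemma fsg_of_cover_generic : fsg K G R.
Proof.
have [mufun [hmul hassoc [one Gone hone]]] := hgrp.
have [D [UD DG Dgen]] := generic_ultrafilter.
exists [set phi | D (defset id phi)], S, e, [set psi], mu; split.
- by [].
- split; [|by split|by split=> //; exists one].
  by apply/seteqP; split=> x; [move=> Gx _ ->|apply].
- split=> [F /finite_set_family[l [f ->]] sub|phi]; last first.
    exact: in_ultra_setVsetC.
  have /filter_ex[x Hx] : D [set x | forall t, defset id (f t) x].
    by apply: filter_forall => t; apply: sub; exists t.
  by exists x => // _ [t _ <-].
- move=> _ ->; apply: filterS DG => x Gx.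
  by apply/sat_push.
move=> g Gg F /finite_set_family[l [f ->]] sub.
have /exists_choice[chi Hchi] t : exists chi, D (defset id chi) /\
    defset id chi = [set a | exists2 d, R g a d & defset id (f t) d].
  by have [|chi Dchi E] := sub (f t); [exists t|exists chi].
have [xi [Hxi _]] : definable (id : U -> U) (fun a : 'I_n -> U =>
    forall t, defset id (chi t) a).
  by codef_tac.
have [|l' [a [Ga gen]]] := Dgen xi.
  have : D [set x | forall t, defset id (chi t) x].
    by apply: filter_forall => t; apply: (Hchi t).1.
  by apply: filterS => x /Hxi.
have [_ _ [h Gh [gh hg]]] := hone _ Gg.
(* For h = g^-1, some point h a_t of h G(S) satisfies xi, and then
   a_t = g (h a_t) satisfies the formulas f of the translate. *)
have [t [b [Rb /Hxi Hb]]] := gen h Gh.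
exists (e \o a t); first by split; [apply: Ga|exists (a t)].
move=> _ [q _ <-]; have := Hb q; rewrite (Hchi q).2 => -[d Rd].
suff -> : d = e \o a t by [].
apply: mufun Rd _; apply: (hassoc _ _ _ one b _ Gg Gh (Ga t) gh Rb).
by have [] := hone _ (Ga t).
Qed.

End FsgFromPartition.

(** * Passing to the Shelah expansion *)

Section Lift.
Variables (L : language) (M N : structure L) (k : M -> N).

Fixpoint term_lift (V : Type) (t : term L V) : term (shelah_language k) V :=
  match t with
  | Var v => Var (shelah_language k) v
  | App f args => @App (shelah_language k) V f (fun x => term_lift (args x))
  end.

Fixpoint lift (V : Type) (phi : formula L V) : formula (shelah_language k) V :=
  match phi with
  | Bot => Bot
  | Eq t u => Eq (term_lift t) (term_lift u)
  | Atom r args => @Atom (shelah_language k) V (inl r) (fun x => term_lift (args x))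
  | Imp p q => Imp (lift p) (lift q)
  | All p => All (lift p)
  end.

Lemma eval_lift (S : structure (shelah_language k)) V (t : term L V) (a : V -> S) :
  eval a (term_lift t) = eval (a : V -> reduct S) t.
Proof. by elim: t => //= f args IH; congr fun_int; apply/funext. Qed.

Lemma sat_lift (S : structure (shelah_language k)) V (phi : formula L V) (a : V -> S) :
  sat a (lift phi) <-> sat (a : V -> reduct S) phi.
Proof.
elim: phi a => {V} [V|V t u|V r args|V p IHp q IHq|V p IH] a //=.
- by rewrite !eval_lift.
- rewrite (_ : (fun x => @eval _ S V a (term_lift (args x))) =
    (fun x => @eval _ (reduct S) V a (args x))) //.
  by apply/funext => x; apply: eval_lift.
- by rewrite IHp IHq.
- by split=> H b; apply/IH/H.
Qed.

Lemma eval_shelah V (t : term L V) (a : V -> M) :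
  eval (a : V -> reduct (shelah k)) t = eval a t.
Proof. by elim: t => //= f args IH; congr fun_int; apply/funext. Qed.

Lemma sat_shelah V (phi : formula L V) (a : V -> M) :
  sat (a : V -> reduct (shelah k)) phi <-> sat a phi.
Proof.
elim: phi a => {V} [V|V t u|V r args|V p IHp q IHq|V p IH] a //=.
- by rewrite !eval_shelah.
- rewrite (_ : (fun x => @eval _ (reduct (shelah k)) V a (args x)) =
    (fun x => @eval _ M V a (args x))) //.
  by apply/funext => x; apply: eval_shelah.
- by rewrite IHp IHq.
- by split=> H b; apply/IH/H.
Qed.

Lemma sat_lift_shelah V (phi : formula L V) (a : V -> M) :
  sat (a : V -> shelah k) (lift phi) <-> sat a phi.
Proof. by rewrite sat_lift sat_shelah. Qed.

Lemma group_axioms_lift n (psi : formula L ('I_n + M))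
    (nu : formula L ('I_n + 'I_n + 'I_n + M)) :
  group_axioms id psi nu ->
  group_axioms (id : shelah k -> shelah k) (lift psi) (lift nu).
Proof.
rewrite /group_axioms.
have -> : @defset (shelah_language k) (shelah k) M 'I_n id (lift psi) =
  @defset L M M 'I_n id psi by apply/seteqP; split=> x /sat_lift_shelah.
have -> // : @graph (shelah_language k) (shelah k) M n id (lift nu) =
  @graph L M M n id nu.
by do 3 apply/funext => ?; apply/propext; apply: sat_lift_shelah.
Qed.

End Lift.

(** Over [M], a formula of the expanded language is an instance of a formula of
    [L] with external parameters, and test points work for all parameters of the
    monster model.  As they lie in [M] and do not depend on the parameters, what
    they achieve is a first-order property [P] of the expansion. *)
Lemma shelah_cover_generic (L : language) (M U N : structure L) (j : M -> U)
    (k : M -> N) n (psi : formula L ('I_n + M))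
    (nu : formula L ('I_n + 'I_n + 'I_n + M)) (U' : structure (shelah_language k))
    (j' : shelah k -> U') :
  elementary j -> group_axioms j psi nu ->
  (forall V (phi : formula (shelah_language k) V),
    external j (fun a : V -> M => sat (a : V -> shelah k) phi)) ->
  (forall (I Y : finType) (phi : I -> formula L ('I_n + Y)),
    exists l (a : 'I_l -> 'I_n -> M), (forall t, defset j psi (j \o a t)) /\
    forall y : Y -> U, (forall t, exists s, sat (env (j \o a t) y) (phi s)) ->
      exists s, forall g, defset j psi g -> exists t h,
        graph j nu g (j \o a t) h /\ sat (env h y) (phi s)) ->
  elementary j' ->
  forall (I Y : finType) (phi : I -> formula (shelah_language k) ('I_n + Y))
    (y : Y -> U'),
  (forall x, defset j' (lift k psi) x -> exists s, sat (env x y) (phi s)) ->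
  exists s, generic j' (lift k psi) (lift k nu) [set x | sat (env x y) (phi s)].
Proof.
move=> hj axU qe test hj' I Y phi y cov.
have axM : group_axioms id psi nu by apply/(group_axioms_elementary _ _ hj).
have [W0 /exists_choice[phi0 /exists_choice[d0 Hphi0]]] :=
  exists_choice (fun s => qe _ (phi s)).
have [W [d [r Hd]]] := common_parameters d0.
pose phiU s : formula L ('I_n + (Y + W)) := rename (fun z => match z with
  | inl (inl x) => inl x | inl (inr y) => inr (inl y) | inr w => inr (inr (r s w))
  end) (phi0 s).
have [l [a [Ga Ha]]] := test I (Y + W)%type phiU.
have phiE s x (b : Y -> M) : sat (env x b : _ -> shelah k) (phi s) <->
    sat (env (j \o x) (env (j \o b) d)) (phiU s).
  rewrite Hphi0 sat_rename; apply: sat_eq; apply/funext; case=> [[]|w] //=.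
  by rewrite -(Hd s).
have GjE x : defset (id : M -> M) psi x <-> defset j psi (j \o x).
  by rewrite /defset /= (elementary_sat _ _ hj) comp_env.
have RjE x1 x2 x3 : graph (id : M -> M) nu x1 x2 x3 <->
    graph j nu (j \o x1) (j \o x2) (j \o x3).
  by rewrite /graph (elementary_sat _ _ hj) !comp_env.
have GaM t : defset (id : M -> M) psi (a t) by apply/GjE.
pose P (S : structure (shelah_language k)) (c : shelah k -> S) :=
  forall b : Y -> S,
    (forall x, defset c (lift k psi) x -> exists s, sat (env x b) (phi s)) ->
    exists s, forall g, defset c (lift k psi) g -> exists t, exists h : 'I_n -> S,
      graph c (lift k nu) g (c \o a t) h /\ sat (env h b) (phi s).
have PM : P (shelah k) id.
  move=> b covb; have [t|s Hs] := Ha (env (j \o b) d).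
    have [|s Hs] := covb (a t); first exact/sat_lift_shelah/GaM.
    by exists s; apply/phiE.
  exists s => g /sat_lift_shelah Gg.
  have [t [h [Rh sh]]] := Hs (j \o g) ((GjE g).1 Gg).
  have [_ [hmul _ _]] := axM; have [h' _ Hh'] := hmul _ _ Gg (GaM t).
  have Rh' : graph id nu g (a t) h' by apply/Hh'.
  have hh' : h = j \o h' by apply: axU.1 Rh _; apply/RjE.
  by exists t, h'; split; [apply/sat_lift_shelah|apply/phiE; rewrite -hh'].
have PU' : P U' j'.
  have cd : codef (id : shelah k -> shelah k) (j' \o id)
      (fun _ : void -> shelah k => P _ id) (fun _ : void -> U' => P _ j').
    rewrite -[j' \o id]/j' /P; apply: codef_all.
    have ha V t : cotuple (id : shelah k -> shelah k) j'
        (fun _ : V -> shelah k => id \o a t) (fun _ : V -> U' => j' \o a t).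
      by exists (inr \o a t).
    apply: codef_imp; first by codef_tac.
    apply: codef_exists_fin => s; apply: codef_all; apply: codef_imp.
      by codef_tac.
    apply: codef_exists_fin => t; apply: codef_ex; apply: codef_and.
      by apply: codef_graph => //; cotuple_tac.
    by codef_tac.
  exact: (codef_transfer (of_void (shelah k)) hj' cd).1.
have [s Hs] := PU' y cov; exists s, l, a; split=> // t.
have := (elementary_sat (lift k psi) (env (a t) id : _ -> shelah k) hj').1.
rewrite comp_env; apply; exact/sat_lift_shelah/GaM.
Qed.

Theorem theorem3p14
  (L : language) (T : set (formula L void))
  (hT : complete_theory T) (hNIP : NIP_theory T)
  (* M0, M, U is an elementary chain, with M0 a model of T and U a monster model *)
  (M0 M U : structure L) (hM0 : models T M0)
  (i : M0 -> M) (hi : elementary i) (hMsat : succ_saturated M0 M)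
  (K : Type) (hU : monster K U) (j : M -> U) (hj : elementary j)
  (hMsmall : card_lt M K)
  (* the type-definable group G over M0 *)
  (n : nat) (pi : set (formula L ('I_n + M0)))
  (mu : formula L ('I_n + 'I_n + 'I_n + M0))
  (hG : type_definable_group (j \o i) pi mu
          (typeset (j \o i) pi) (graph (j \o i) mu))
  (hfsg : fsg K (typeset (j \o i) pi) (graph (j \o i) mu))
  (* N is used to form the Shelah expansion of M *)
  (N : structure L) (k : M -> N) (hk : elementary k)
  (hNsat : succ_saturated M N)
  (hSh : exists chi : formula (shelah_language k) ('I_n + shelah k),
      typeset i pi = defset (id : shelah k -> shelah k) chi) :
  exists (psi : formula L ('I_n + M)) (nu : formula L ('I_n + 'I_n + 'I_n + M)),
    definable_group j psi nu (typeset (j \o i) pi) (graph (j \o i) mu) /\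
    (* in T' = Th(shelah k), with monster model U' containing shelah k *)
    forall (K' : Type) (U' : structure (shelah_language k))
           (j' : shelah k -> U'),
      monster K' U' -> elementary j' -> card_lt M K' ->
      exists (psi' : formula (shelah_language k) ('I_n + shelah k))
             (nu' : formula (shelah_language k)
                      ('I_n + 'I_n + 'I_n + shelah k)),
        definable_group j' psi' nu'
          (defset (j' : M -> reduct U') psi) (graph (j' : M -> reduct U') nu) /\
        @fsg K' (shelah_language k) U' n
          (defset (j' : M -> reduct U') psi)
          (graph (j' : M -> reduct U') nu).
Proof.
have hTU : models T U.
  move=> sigma Ts; have := hM0 _ Ts; rewrite (elementary_sat _ _ hi) (elementary_sat _ _ hj).
  by congr sat; apply/funext; case.
have bounded (V W : finType) (phi : formula L (V + W)) :
    exists r, forall u : power V r -> U, ~ shattered phi u.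
  exact: (NIP_bounded_shattering phi hU hNIP hTU).
have qe V := shelah_external hU hj hMsmall bounded hk (V := V).
have [_ [mufun _] hgrp] := hG.
have [psi0 Gpsi0] : exists psi : formula L ('I_n + M0),
    typeset (j \o i) pi = defset (j \o i) psi.
  have [chi Hchi] := hSh.
  have [W [phi [d Hphi]]] := qe _ chi.
  (* The parameters of chi in M and the external ones are read together by
     [env j d]; finitely many of them occur. *)
  have [Y [b [phi' Hphi']]] := formula_fin_params (fun z : 'I_n + M + W => match z with
    inl (inl x) => inl x | inl (inr m) => inr (inl m) | inr w => inr (inr w) end) phi.
  have GM x : typeset i pi x <-> sat (env (j \o x) (env j d \o b)) phi'.
    rewrite -Hphi' Hchi /defset /= -[X in X <-> _]/(sat (env x id : _ -> shelah k) chi) Hphi.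
    by apply: sat_eq; apply/funext; case=> // -[].
  have [r unsh] := bounded _ _ phi'.
  have [Z [theta honest]] := honest_definition hj (env j d \o b) unsh.
  apply: (fsg_definable hU hi hj hMsat hMsmall hgrp hfsg (theta := theta)).
  move=> l f fG; have [|c [c1 c2]] := honest l f.
    by move=> t; apply/GM; apply: fG.
  by exists c; split=> // x /c2 /GM.
pose psi := push_params i psi0; pose nu := push_params i mu; exists psi, nu.
have GE : typeset (j \o i) pi = defset j psi.
  by rewrite Gpsi0; apply/seteqP; split=> x /sat_push.
have RE : graph (j \o i) mu = graph j nu.
  by do 3 apply/funext => ?; apply/propext; split=> /sat_push.
have test (I Y : finType) (phi : I -> formula L ('I_n + Y)) :=
  uniform_test_points hU hi hj hMsat hMsmall phi hfsg.
rewrite GE RE in test mufun hgrp *.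
have axU : group_axioms j psi nu by split.
have axM : group_axioms id psi nu by apply/(group_axioms_elementary _ _ hj).
split; first exact: definable_groupP.
move=> K' U' j' hU' hj' hMsmall'; exists (lift k psi), (lift k nu).
have -> : defset (j' : M -> reduct U') psi = defset j' (lift k psi).
  by apply/seteqP; split=> x /sat_lift.
have -> : graph (j' : M -> reduct U') nu = graph j' (lift k nu).
  by do 3 apply/funext => ?; apply/propext; split=> /sat_lift.
have axU' : group_axioms j' (lift k psi) (lift k nu).
  by apply/(group_axioms_elementary _ _ hj'); apply: group_axioms_lift.
split; first exact: definable_groupP.
apply: fsg_of_cover_generic => // I Y phi y.
by apply: (shelah_cover_generic hj axU qe test).
Qed.
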